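(* The following decision problem is in $\Pi_3^p$: given a finite default theory $\Delta=\langle D,W\rangle$, a strict partial order $\mathcal{P}$ on $D$ and a formula $\phi\in\mathcal{L}$, decide whether $\phi$ belongs to all $\mathcal{P}$-preferred$^L$ extensions of $\Delta$.
   Context: $\mathcal{L}$ is the set of formulae of classical propositional logic, $\models$ classical logical consequence, and $Cn(S)=\{\phi\in\mathcal{L}\mid S\models\phi\}$ for $S\subseteq\mathcal{L}$. A default is a rule $\alpha{:}\beta_1,\ldots,\beta_n/\gamma$ with $\alpha,\beta_1,\ldots,\beta_n,\gamma\in\mathcal{L}$ (prerequisite $\alpha$, justifications $\beta_j$, conclusion $\gamma$). A default theory is a pair $\langle D,W\rangle$ with $D$ a set of defaults and $W\subseteq\mathcal{L}$. (Reiter) extensions: for $S\subseteq\mathcal{L}$ let $\Gamma(S)$ be the smallest set such that $W\subseteq\Gamma(S)$, $Cn(\Gamma(S))=\Gamma(S)$, and whenever $\alpha{:}\beta_1,\ldots,\beta_n/\gamma\in D$, $\alpha\in\Gamma(S)$ and $\{\neg\beta_1,\ldots,\neg\beta_n\}\cap S=\emptyset$, then $\gamma\in\Gamma(S)$. $E\subseteq\mathcal{L}$ is an extension of $\langle D,W\rangle$ iff $\Gamma(E)=E$. A default $\alpha{:}\beta_1,\ldots,\beta_n/\gamma$ is applied in $E$, written $\mathrm{appl}(\delta,E)$ for this default $\delta$, if $E\models\alpha$ and $\{\neg\beta_1,\ldots,\neg\beta_n\}\cap Cn(E)=\emptyset$. $\mathrm{appl}(\delta,E,E')$ abbreviates ''$\mathrm{appl}(\delta,E)$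 and not $\mathrm{appl}(\delta,E')$''. Let $\mathcal{P}$ be a strict partial order (transitive, asymmetric) on $D$; $\delta\mathcal{P}\delta'$ means $\delta$ has higher priority. An extension $E$ of $\Delta=\langle D,W\rangle$ is a $\mathcal{P}$-preferred$^L$ extension of $\Delta$ if there is a strict total order $\mathcal{T}$ on $D$ such that $\mathcal{P}\subseteq\mathcal{T}$ and for all extensions $E'$ of $\Delta$ and all $\delta\in D$: $\mathrm{appl}(\delta,E',E)$ implies that for some $\epsilon\in D$, $\epsilon\mathcal{T}\delta$ and $\mathrm{appl}(\epsilon,E,E')$. *)

(* Defs.v *)
(* MathComp, with sets from mathcomp-classical. *)
From Corelib Require Import PosDef.
From HB Require Import structures.
From mathcomp Require Import all_boot all_order all_algebra.
From mathcomp Require Import boolp classical_sets.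

Set Implicit Arguments.
Unset Strict Implicit.
Unset Printing Implicit Defensive.

Local Open Scope classical_set_scope.

(** * Propositional logic and default logic *)

Inductive formula : Type :=
  | Var of nat
  | Top
  | Bot
  | Neg of formula
  | And of formula & formula
  | Or of formula & formula
  | Imp of formula & formula
  | Iff of formula & formula.

Lemma formula_comparable : comparable formula.
Proof. by move=> x y; rewrite /decidable; do !decide equality. Defined.

HB.instance Definition _ := hasDecEq.Build formula (compareP formula_comparable).

Fixpoint eval (v : nat -> bool) (f : formula) : bool :=
  match f with
  | Var n => v n
  | Top => true
  | Bot => false
  | Neg a => ~~ eval v a
  | And a b => eval v a && eval v b
  | Or a b => eval v a || eval v b
  | Imp a b => eval v a ==> eval v b
  | Iff a b => eval v a == eval v b
  end.

Definition entails (S : set formula) (f : formula) : Prop :=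
  forall v, (forall g, S g -> eval v g) -> eval v f.

Definition Cn (S : set formula) : set formula := [set f | entails S f].

Record default := Default {
  prereq : formula;
  justs : seq formula;
  concl : formula
}.

Lemma default_comparable : comparable default.
Proof.
move=> x y; rewrite /decidable; decide equality;
  [exact: formula_comparable | | exact: formula_comparable].
by decide equality; exact: formula_comparable.
Defined.

HB.instance Definition _ := hasDecEq.Build default (compareP default_comparable).

Definition neg_justs (d : default) : set formula :=
  [set Neg b | b in [set` justs d]].

Section DefaultTheory.
Variables (D : set default) (W : set formula).

Definition Gamma_closed (S X : set formula) : Prop :=
  Cn X = X /\
  forall d, D d -> X (prereq d) -> neg_justs d `&` S = set0 -> X (concl d).

Definition Gamma (S : set formula) : set formula := smallest (Gamma_closed S) W.

Lemma GammaP (S : set formula) : Gamma_closed S (Gamma S).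
Proof.
split.
  apply/seteqP; split=> f; last by move=> Gf v; apply.
  move=> ent X [[CnX DX] WX]; rewrite -CnX => v vX; apply: ent => g Gg.
  by apply: vX; apply: Gg.
move=> d Dd pre just X [[CnX DX] WX]; apply: (DX d) => //.
by apply: (pre X); split.
Qed.

Definition extension (E : set formula) : Prop := Gamma E = E.

Definition appl (d : default) (E : set formula) : Prop :=
  entails E (prereq d) /\ neg_justs d `&` Cn E = set0.

Definition appl_not (d : default) (E E' : set formula) : Prop :=
  appl d E /\ ~ appl d E'.

Definition strict_partial_order_on (P : default -> default -> Prop) : Prop :=
  [/\ forall d e, P d e -> D d /\ D e,
      forall d e f, P d e -> P e f -> P d f
    & forall d e, P d e -> ~ P e d].

Definition strict_total_order_on (T : default -> default -> Prop) : Prop :=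
  strict_partial_order_on T /\
  forall d e, D d -> D e -> d <> e -> T d e \/ T e d.

Definition preferred (P : default -> default -> Prop) (E : set formula) : Prop :=
  extension E /\
  exists T : default -> default -> Prop,
    [/\ strict_total_order_on T,
        forall d e, P d e -> T d e
      & forall E' d, extension E' -> D d -> appl_not d E' E ->
          exists e, [/\ D e, T e d & appl_not e E E']].

End DefaultTheory.

(** * Problem instances and their binary encoding *)

(* The lists stand for the finite sets of their members. *)
Record instance := Instance {
  defaults : seq default;
  facts : seq formula;
  priority : seq (default * default);
  query : formula
}.

Definition prio_rel (x : instance) (d e : default) : Prop :=
  (d, e) \in priority x.

Definition valid_instance (x : instance) : Prop :=
  strict_partial_order_on [set` defaults x] (prio_rel x).

Definition skeptical_consequence (x : instance) : Prop :=
  forall E, preferred [set` defaults x] [set` facts x] (prio_rel x) E ->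
    E (query x).

(* Every encoder below is prefix-free, so plain concatenation is uniquely
   decodable. Variable indices are written in binary, least significant bit
   first; formulas are in Polish notation with 3-bit connectives. *)

Definition enc_seq (T : Type) (enc : T -> seq bool) (s : seq T) : seq bool :=
  flatten [seq true :: enc x | x <- s] ++ [:: false].

Fixpoint pos_bits (p : positive) : seq bool :=
  match p with
  | xH => [:: true]
  | xO p' => false :: pos_bits p'
  | xI p' => true :: pos_bits p'
  end.

Definition nat_bits (n : nat) : seq bool :=
  if bin_of_nat n is Npos p then pos_bits p else [::].

Definition enc_nat (n : nat) : seq bool :=
  enc_seq (fun b => [:: b]) (nat_bits n).

Fixpoint enc_formula (f : formula) : seq bool :=
  match f with
  | Var n => [:: false; false; false] ++ enc_nat n
  | Top => [:: false; false; true]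
  | Bot => [:: false; true; false]
  | Neg a => [:: false; true; true] ++ enc_formula a
  | And a b => [:: true; false; false] ++ enc_formula a ++ enc_formula b
  | Or a b => [:: true; false; true] ++ enc_formula a ++ enc_formula b
  | Imp a b => [:: true; true; false] ++ enc_formula a ++ enc_formula b
  | Iff a b => [:: true; true; true] ++ enc_formula a ++ enc_formula b
  end.

Definition enc_default (d : default) : seq bool :=
  enc_formula (prereq d) ++ enc_seq enc_formula (justs d) ++
  enc_formula (concl d).

Definition enc_instance (x : instance) : seq bool :=
  enc_seq enc_default (defaults x) ++
  enc_seq enc_formula (facts x) ++
  enc_seq (fun p => enc_default p.1 ++ enc_default p.2) (priority x) ++
  enc_formula (query x).

Definition skeptical_language : set (seq bool) :=
  [set s | exists x, [/\ valid_instance x, skeptical_consequence x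
                       & s = enc_instance x]].

(** * Deterministic multi-tape Turing machines *)

Inductive move := MoveLeft | Stay | MoveRight.

(* A tape symbol is [None] (blank), [Some (inl a)] with [a] an input symbol, or
   [Some (inr c)] with [c] an auxiliary symbol. There are [ntapes.+1] tapes, the
   input being written on tape [ord0]. A state with verdict [Some b] is halting,
   accepting if [b] and rejecting otherwise. *)
Record TM (Sigma : finType) := MkTM {
  ntapes : nat;
  work : finType;
  state : finType;
  start : state;
  verdict : state -> option bool;
  delta : state -> {ffun 'I_ntapes.+1 -> option (Sigma + work)} ->
    state * {ffun 'I_ntapes.+1 -> option (Sigma + work) * move}
}.

Section Run.
Variables (Sigma : finType) (M : TM Sigma).

Definition symbol : Type := option (Sigma + work M).

(* Two-way infinite tape: [lefts] lists the cells left of the head, nearest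
   first; [rights] starts with the scanned cell. All unlisted cells are blank. *)
Record tape := Tape { lefts : seq symbol; rights : seq symbol }.

Definition read (t : tape) : symbol := head None (rights t).

Definition write_move (t : tape) (a : symbol * move) : tape :=
  let r := behead (rights t) in
  match a.2 with
  | MoveLeft => Tape (behead (lefts t)) (head None (lefts t) :: a.1 :: r)
  | Stay => Tape (lefts t) (a.1 :: r)
  | MoveRight => Tape (a.1 :: lefts t) r
  end.

Record config := Config {
  cstate : state M;
  ctapes : {ffun 'I_(ntapes M).+1 -> tape}
}.

Definition init (w : seq Sigma) : config :=
  Config (start M)
    [ffun i => Tape [::] (if i == ord0 then [seq Some (inl a) | a <- w] else [::])].

Definition step (c : config) : config :=
  if verdict (cstate c) is Some _ then c else
  let: (q, acts) := delta (cstate c) [ffun i => read (ctapes c i)] in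
  Config q [ffun i => write_move (ctapes c i) (acts i)].

Definition outcome (t : nat) (w : seq Sigma) : option bool :=
  verdict (cstate (iter t step (init w))).

End Run.

(** * Polynomial time and the polynomial hierarchy *)

Definition in_P (Sigma : finType) (L : set (seq Sigma)) : Prop :=
  exists (M : TM Sigma) (p : {poly nat}),
    forall w, exists (t : nat) (b : bool),
      [/\ (t <= p.[size w]%R)%N, outcome M t w = Some b & b <-> L w].

(* Tuples of binary strings as strings over [bool] and a separator [None]. *)
Definition tuple_string (us : seq (seq bool)) : seq (option bool) :=
  flatten [seq rcons (map Some u) None | u <- us].

(* [alternation univ i n R us] appends [i] strings of length at most [n] to
   [us], with alternating quantifiers, the first being universal iff [univ]. *)
Fixpoint alternation (univ : bool) (i n : nat) (R : set (seq (seq bool)))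
    (us : seq (seq bool)) : Prop :=
  if i is j.+1 then
    if univ then
      forall u, (size u <= n)%N -> alternation false j n R (rcons us u)
    else
      exists u, (size u <= n)%N /\ alternation true j n R (rcons us u)
  else R us.

Definition in_Pi_p (i : nat) (L : set (seq bool)) : Prop :=
  exists (R : set (seq (option bool))) (q : {poly nat}),
    in_P R /\
    forall x, L x <->
      alternation true i q.[size x]%R [set us | R (tuple_string us)] [:: x].

(* Main.v *)
(* An extension E is determined by the list G of the defaults applied in it, and
   E = Cn (W + conclusions of G). Listing G in an order of application and
   adding models of E for the satisfiable ones among the formulas that matter,
   "G generates an extension" takes the form: for all valuations v, a
   polynomial-time check. Since appl (d, E) is membership in G, the preference
   condition between two extensions is a combinatorial condition on their lists
   and on the order T. Hence "E is a preferred extension without the query" is: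
   there are a certificate for E and T such that for all challenges to it and
   all certificates for some E', a challenge to E' succeeds or E' does not beat E;
   negating this gives the quantifier prefix of Pi_3.

   For the polynomial-time machine, data are binary trees written in prefix
   notation on a stack. Functions on them closed under composition, pairing,
   case analysis and bounded iteration are computed by a structured language
   with four stacks, each of which is simulated by one tape. *)

Require Import Defs.
From Corelib Require Import PosDef BinNums.
From mathcomp Require Import all_boot all_order all_algebra.
From mathcomp Require Import boolp classical_sets.
From mathcomp Require Import zify.

Set Implicit Arguments.
Unset Strict Implicit.
Unset Printing Implicit Defensive.

Local Open Scope classical_set_scope.

(** The input is a bit string, but the machine never parses it as an instance: the existential
    player sends the decoded instance with the reply, and the verifier encodes it again and
    compares. It has to be this player, since a word that encodes no valid instance must lose.
    Injectivity of the encoding makes all replies speak of the same instance.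

    Being an extension mixes entailments, which quantify universally over valuations, with
    non-entailments, which need models. The models go into the certificate, so a single challenge
    remains. The challenge to [E] and the certificate of [E'] belong to the same player and share
    one move, which keeps the prefix at three blocks.

    Moves must be short: challenges are cut down to the variables of the instance, and an order is
    listed as pairs of defaults.

    On the machine side the obstacle is iteration: a step that is polynomial in its own argument may
    blow up when repeated. Time is therefore measured in the size of the code of the argument, and
    each loop comes with a bound on its intermediate values. *)

Notation sgn := (option bool).

(** * A structured language on four stacks and its cost *)

Variant reg := R0 | R1 | R2 | R3.

Definition reg_idx (r : reg) : 'I_4 :=
  match r with
  | R0 => ord0
  | R1 => @Ordinal 4 1 isT
  | R2 => @Ordinal 4 2 isT
  | R3 => @Ordinal 4 3 isT
  end.

Lemma reg_idx_inj : injective reg_idx.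
Proof. by case; case. Qed.

Record store := Store {
  stack0 : seq sgn; stack1 : seq sgn; stack2 : seq sgn; stack3 : seq sgn
}.

Definition content (s : store) (r : reg) : seq sgn :=
  match r with
  | R0 => stack0 s | R1 => stack1 s | R2 => stack2 s | R3 => stack3 s
  end.

Definition put (s : store) (r : reg) (x : seq sgn) : store :=
  let: Store a b c d := s in
  match r with
  | R0 => Store x b c d
  | R1 => Store a x c d
  | R2 => Store a b x d
  | R3 => Store a b c x
  end.

Lemma content_put (s : store) (r r' : reg) (x : seq sgn) :
  content (put s r x) r' = if reg_idx r' == reg_idx r then x else content s r'.
Proof. by case: s r r' => [a b c d] [] []. Qed.

Inductive cmd :=
  | Push of reg & sgn
  | Pop of reg
  | Seq of cmd & cmd
  | If of reg & (option sgn -> bool) & cmd & cmd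
  | While of reg & (option sgn -> bool) & cmd.

(** The last index counts steps of the machine that simulates the command: two for a push, one for a
    pop, one for each test. Sequencing is free, because the last step of the first command already
    enters the second. *)
Inductive exec : cmd -> store -> store -> nat -> Prop :=
  | ExecPush r a s : exec (Push r a) s (put s r (a :: content s r)) 2
  | ExecPop r s : exec (Pop r) s (put s r (behead (content s r))) 1
  | ExecSeq c1 c2 s s1 s2 t1 t2 :
      exec c1 s s1 t1 -> exec c2 s1 s2 t2 -> exec (Seq c1 c2) s s2 (t1 + t2)
  | ExecIfTrue r (p : option sgn -> bool) c1 c2 s s' t : p (ohead (content s r)) ->
      exec c1 s s' t -> exec (If r p c1 c2) s s' t.+1
  | ExecIfFalse r (p : option sgn -> bool) c1 c2 s s' t : p (ohead (content s r)) = false ->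
      exec c2 s s' t -> exec (If r p c1 c2) s s' t.+1
  | ExecWhileFalse r (p : option sgn -> bool) c s : p (ohead (content s r)) = false ->
      exec (While r p c) s s 1
  | ExecWhileTrue r (p : option sgn -> bool) c s s1 s2 t1 t2 : p (ohead (content s r)) ->
      exec c s s1 t1 -> exec (While r p c) s1 s2 t2 ->
      exec (While r p c) s s2 (t1 + t2).+1.

Lemma exec_size (c : cmd) (s s' : store) (t : nat) (r : reg) :
  exec c s s' t -> size (content s' r) <= size (content s r) + t.
Proof.
elim=> {c s s' t}.
- by move=> r' a s; rewrite content_put; case: eqP => [/reg_idx_inj->|_] /=; lia.
- move=> r' s; rewrite content_put; case: eqP => [/reg_idx_inj->|_] /=; last by lia.
  by rewrite size_behead; lia.
- by move=> c1 c2 s s1 s2 t1 t2 _ H1 _ H2; lia.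
- by move=> r' p c1 c2 s s' t _ _; lia.
- by move=> r' p c1 c2 s s' t _ _; lia.
- by move=> *; lia.
- by move=> r' p c s s1 s2 t1 t2 _ _ H1 _ H2; lia.
Qed.

(* A register is implemented by a tape whose scanned cell is the top of the
   stack and whose cells to the left of the head are all blank. A command acts
   on one tape per step; pushing takes a left move followed by a write. *)
Variant act := ANop | APop of reg | ALeft of reg | AWrite of reg & sgn.

Definition cells := reg -> seq (option sgn).

Definition scan (x : cells) (r : reg) : option sgn := head None (x r).

(** Each machine step rewrites the scanned cell of every tape, so an idle empty list becomes
    [[:: None]]. Recording this makes the later correspondence with tapes an equality of lists. *)
Definition act_on (ac : act) (r : reg) (x : seq (option sgn)) :
    seq (option sgn) :=
  let x' := head None x :: behead x in
  match ac with
  | ANop => x'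
  | APop r' => if reg_idx r == reg_idx r' then behead x else x'
  | ALeft r' => if reg_idx r == reg_idx r' then None :: x' else x'
  | AWrite r' a => if reg_idx r == reg_idx r' then Some a :: behead x else x'
  end.

Definition micro (ac : act) (x : cells) : cells := fun r => act_on ac r (x r).

Definition represents (x : cells) (s : store) : Prop :=
  forall r, exists k, x r = map Some (content s r) ++ nseq k None.

(** * Control states of a command and their simulation of its runs *)

Fixpoint st (c : cmd) : finType :=
  match c with
  | Push _ _ => bool
  | Pop _ => unit
  | Seq c1 c2 => (st c1 + st c2)%type
  | If _ _ c1 c2 => option (st c1 + st c2)
  | While _ _ c => option (st c)
  end.

Fixpoint entry (c : cmd) : st c :=
  match c with
  | Push _ _ => false
  | Pop _ => tt
  | Seq c1 c2 => inl (entry c1)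
  | If _ _ _ _ => None
  | While _ _ _ => None
  end.

(* The next state is [None] when control leaves the command. *)
Fixpoint tr (c : cmd) : st c -> (reg -> option sgn) -> option (st c) * act :=
  match c with
  | Push r a => fun q _ =>
      if q then (None, AWrite r a) else (Some true, ALeft r)
  | Pop r => fun _ _ => (None, APop r)
  | Seq c1 c2 => fun q x =>
      match q with
      | inl q1 => let: (q', ac) := tr q1 x in
          (Some (if q' is Some q'' then inl q'' else inr (entry c2)), ac)
      | inr q2 => let: (q', ac) := tr q2 x in (omap inr q', ac)
      end
  | If r p c1 c2 => fun q x =>
      match q with
      | None =>
          (Some (Some (if p (x r) then inl (entry c1) else inr (entry c2))),
           ANop)
      | Some (inl q1) => let: (q', ac) := tr q1 x in
          (omap (fun q'' => Some (inl q'')) q', ac)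
      | Some (inr q2) => let: (q', ac) := tr q2 x in
          (omap (fun q'' => Some (inr q'')) q', ac)
      end
  | While r p c => fun q x =>
      match q with
      | None => (if p (x r) then Some (Some (entry c)) else None, ANop)
      | Some q1 => let: (q', ac) := tr q1 x in (Some q', ac)
      end
  end.

(** A run lasts until control leaves the command; the leaving step is counted and its action is
    performed. *)
Inductive fruns (c : cmd) : st c -> cells -> nat -> cells -> Prop :=
  | FrunsExit q x ac : tr q (scan x) = (None, ac) -> fruns q x 1 (micro ac x)
  | FrunsStep q x q' ac n x' : tr q (scan x) = (Some q', ac) ->
      fruns q' (micro ac x) n x' -> fruns q x n.+1 x'.

Lemma fruns_seq (c1 c2 : cmd) (q : st c1) (x x1 x2 : cells) (n m : nat) :
  fruns q x n x1 -> fruns (entry c2) x1 m x2 ->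
  fruns (inl q : st (Seq c1 c2)) x (n + m) x2.
Proof.
have inr_run (q2 : st c2) y k y' :
    fruns q2 y k y' -> fruns (inr q2 : st (Seq c1 c2)) y k y'.
  elim=> {q2 y k y'} [q2 y ac E|q2 y q' ac k y' E _ IH].
    by apply: FrunsExit; rewrite /= E.
  by apply: FrunsStep IH; rewrite /= E.
elim=> {q x n x1} [q x ac E|q x q' ac n x1 E _ IH] H2.
  apply: (@FrunsStep (Seq c1 c2) _ _ (inr (entry c2)) ac); last exact: inr_run.
  by rewrite /= E.
by apply: FrunsStep (IH H2); rewrite /= E.
Qed.

Lemma fruns_if (r : reg) (p : option sgn -> bool) (c1 c2 : cmd)
    (x x' : cells) (n : nat) :
  (if p (scan x r) then fruns (entry c1) (micro ANop x) n x'
   else fruns (entry c2) (micro ANop x) n x') ->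
  fruns (entry (If r p c1 c2)) x n.+1 x'.
Proof.
have inl_run (q1 : st c1) y k y' :
    fruns q1 y k y' -> fruns (Some (inl q1) : st (If r p c1 c2)) y k y'.
  elim=> {q1 y k y'} [q1 y ac E|q1 y q' ac k y' E _ IH].
    by apply: FrunsExit; rewrite /= E.
  by apply: FrunsStep IH; rewrite /= E.
have inr_run (q2 : st c2) y k y' :
    fruns q2 y k y' -> fruns (Some (inr q2) : st (If r p c1 c2)) y k y'.
  elim=> {q2 y k y'} [q2 y ac E|q2 y q' ac k y' E _ IH].
    by apply: FrunsExit; rewrite /= E.
  by apply: FrunsStep IH; rewrite /= E.
case Ep: (p (scan x r)) => H; apply: FrunsStep; rewrite /= ?Ep //.
- exact: inl_run.
- exact: inr_run.
Qed.

Lemma fruns_while (r : reg) (p : option sgn -> bool) (c : cmd)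
    (x x1 x2 : cells) (n m : nat) :
  p (scan x r) -> fruns (entry c) (micro ANop x) n x1 ->
  fruns (entry (While r p c)) x1 m x2 ->
  fruns (entry (While r p c)) x (n + m).+1 x2.
Proof.
move=> Ep H1 H2.
suff body q y k z : fruns q y k z -> fruns (entry (While r p c)) z m x2 ->
    fruns (Some q : st (While r p c)) y (k + m) x2.
  by apply: FrunsStep (body _ _ _ _ H1 H2); rewrite /= Ep.
elim=> {q y k z} [q y ac E|q y q' ac k z E _ IH] H.
  by apply: FrunsStep (H); rewrite /= E.
by apply: FrunsStep (IH H); rewrite /= E.
Qed.

Lemma scan_represents (x : cells) (s : store) (r : reg) :
  represents x s -> scan x r = ohead (content s r).
Proof. by move/(_ r) => [k]; rewrite /scan => ->; case: (content s r); case: k. Qed.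

Lemma represents_nop (x : cells) (s : store) :
  represents x s -> represents (micro ANop x) s.
Proof.
move=> H r; have [k] := H r; rewrite /micro /= => ->.
case: (content s r) => [|a l] /=; last by exists k.
by case: k => [|k]; [exists 1 | exists k.+1].
Qed.

Lemma fruns_exec (c : cmd) (s s' : store) (t : nat) (x : cells) :
  exec c s s' t -> represents x s ->
  exists2 x', fruns (entry c) x t x' & represents x' s'.
Proof.
move=> H; elim: H x => {c s s' t}.
- move=> r a s x xs.
  exists (micro (AWrite r a) (micro (ALeft r) x)).
    by apply: (FrunsStep (q' := true : st (Push r a)) (ac := ALeft r)) => //;
      apply: FrunsExit.
  have xs' := represents_nop xs; move=> r'; have [k] := xs' r'.
  rewrite content_put /micro /=; case: eqP => [/reg_idx_inj->|_] /=.
    by move=> ->; exists k.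
  by move=> ->; exists k; case: (content s r') k {xs xs'} => [|? ?] [].
- move=> r s x xs; exists (micro (APop r) x).
    exact: FrunsExit.
  have xs' := represents_nop xs; move=> r'; have [k] := xs' r'.
  rewrite content_put /micro /=; case: eqP => [/reg_idx_inj->|_] /=; last first.
    by move=> ->; exists k.
  (* Popping an empty stack moves the head over a blank, so one cell of padding is lost if there is
     any. *)
  have [k' ->] := xs r => _; exists (k' - (content s r == [::])).
  case: (content s r) => [|a l] /=; last by rewrite subn0.
  by case: k' => [|k'] //=; rewrite subSS subn0.
- move=> c1 c2 s s1 s2 t1 t2 _ IH1 _ IH2 x /IH1[x1 H1 /IH2[x2 H2 H]].
  by exists x2 => //; apply: fruns_seq H1 H2.
- move=> r p c1 c2 s s' t Hp _ IH x xs.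
  have [x' H1 H2] := IH _ (represents_nop xs); exists x' => //.
  by apply: fruns_if; rewrite (scan_represents r xs) Hp.
- move=> r p c1 c2 s s' t Hp _ IH x xs.
  have [x' H1 H2] := IH _ (represents_nop xs); exists x' => //.
  by apply: fruns_if; rewrite (scan_represents r xs) Hp.
- move=> r p c s Hp x xs; exists (micro ANop x); last exact: represents_nop.
  by apply: FrunsExit; rewrite /= (scan_represents r xs) Hp.
- move=> r p c s s1 s2 t1 t2 Hp _ IH1 _ IH2 x xs.
  have [x1 H1 /IH2[x2 H2 H]] := IH1 _ (represents_nop xs).
  exists x2 => //; apply: fruns_while H1 H2.
  by rewrite (scan_represents r xs).
Qed.

(** * The Turing machine of a command *)

Section Compile.
Variable c : cmd.

Local Notation sym := (option (sgn + unit)).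

Definition to_sym (a : option sgn) : sym := omap inl a.

Definition of_sym (a : sym) : option sgn :=
  if a is Some (inl b) then Some b else None.

Lemma to_symK : cancel to_sym of_sym.
Proof. by case. Qed.

Definition act_sym (ac : act) (reads : {ffun 'I_4 -> sym}) (i : 'I_4) :
    sym * move :=
  let idle := (reads i, Stay) in
  match ac with
  | ANop => idle
  | APop r => if i == reg_idx r then (None, MoveRight) else idle
  | ALeft r => if i == reg_idx r then (reads i, MoveLeft) else idle
  | AWrite r a => if i == reg_idx r then (Some (inl a), Stay) else idle
  end.

(** Leaving the command leads to [inr None], which does not halt yet: one more step reads the top of
    [R0] and stores the verdict in the state. *)
Definition tm_delta (q : (st c + option bool)%type)
    (reads : {ffun 'I_4 -> sym}) :
    (st c + option bool)%type * {ffun 'I_4 -> sym * move} :=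
  match q with
  | inl q => let: (q', ac) := tr q (fun r => of_sym (reads (reg_idx r))) in
      (if q' is Some q'' then inl q'' else inr None,
       [ffun i => act_sym ac reads i])
  | inr b => (inr (Some (of_sym (reads ord0) == Some (Some true))),
              [ffun i => act_sym ANop reads i])
  end.

Definition tm_verdict (q : (st c + option bool)%type) : option bool :=
  if q is inr b then b else None.

Definition tm : TM sgn :=
  @MkTM sgn 3 unit (st c + option bool)%type (inl (entry c)) tm_verdict
    tm_delta.

Definition tapes_of (T : {ffun 'I_4 -> tape tm}) (x : cells) : Prop :=
  forall r, (exists j, lefts (T (reg_idx r)) = nseq j None) /\
            rights (T (reg_idx r)) = map to_sym (x r).

Lemma read_tapes_of (T : {ffun 'I_4 -> tape tm}) (x : cells) (r : reg) :
  tapes_of T x -> read (T (reg_idx r)) = to_sym (scan x r).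
Proof. by rewrite /read /scan => /(_ r) [_ ->]; case: (x r). Qed.

Lemma tapes_of_micro (T : {ffun 'I_4 -> tape tm}) (x : cells) (ac : act) :
  tapes_of T x ->
  tapes_of [ffun i => write_move (T i)
    (act_sym ac [ffun i => @read _ tm (T i)] i)] (micro ac x).
Proof.
move=> H r; rewrite ffunE; have [[j Hl] Hr] := H r.
have Hd := read_tapes_of r H.
have Hd' : [ffun i => @read _ tm (T i)] (reg_idx r) = to_sym (scan x r).
  by rewrite ffunE.
rewrite /micro /scan in Hd' *; case: ac => [|r'|r'|r' a] /=.
- rewrite Hd' /write_move /= Hl Hr; split; first by exists j.
  by rewrite behead_map.
- case: eqP => _; rewrite /write_move /= ?Hl ?Hr ?Hd'; split=> //=;
    rewrite ?behead_map //; first by exists j.+1.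
  by exists j.
- case: eqP => _; rewrite /write_move /= ?Hl ?Hr ?Hd'; split=> //=;
    rewrite ?behead_map //; [by exists j.-1; case: j {Hl} | | by exists j].
  by case: j {Hl}.
- case: eqP => _; rewrite /write_move /= ?Hl ?Hr ?Hd'; split=> //=;
    rewrite ?behead_map //; by exists j.
Qed.

Lemma tm_runs (q : st c) (x x' : cells) (n : nat) (T : {ffun 'I_4 -> tape tm}) :
  fruns q x n x' -> tapes_of T x ->
  exists2 T', tapes_of T' x' &
    iter n (@step _ tm) (@Config _ tm (inl q) T) = @Config _ tm (inr None) T'.
Proof.
have stepE q0 x0 T0 : tapes_of T0 x0 ->
    @step _ tm (@Config _ tm (inl q0) T0) =
    @Config _ tm (if (tr q0 (scan x0)).1 is Some q' then inl q' else inr None)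
     [ffun i => write_move (T0 i)
       (act_sym (tr q0 (scan x0)).2 [ffun i => @read _ tm (T0 i)] i)].
  move=> H0; rewrite /step /=.
  have -> : (fun r => of_sym ([ffun i => @read _ tm (T0 i)] (reg_idx r))) =
            scan x0.
    by apply: funext => r; rewrite ffunE (read_tapes_of r H0) to_symK.
  case: (tr q0 (scan x0)) => q' ac /=; congr Config.
  by apply/ffunP => i; rewrite !ffunE.
move=> H; elim: H T => {q x n x'} [q x ac E|q x q' ac n x' E _ IH] T HT.
  exists [ffun i => write_move (T i)
    (act_sym ac [ffun i => @read _ tm (T i)] i)].
    exact: tapes_of_micro.
  by rewrite /iter (stepE _ _ _ HT) E.
have [T' HT' E'] := IH _ (tapes_of_micro ac HT); exists T' => //.
by rewrite iterSr (stepE _ _ _ HT) E.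
Qed.

Lemma tm_outcome (w : seq sgn) (s' : store) (t : nat) :
  exec c (Store w [::] [::] [::]) s' t ->
  outcome tm t.+1 w = Some (ohead (stack0 s') == Some (Some true)).
Proof.
move=> H; pose x : cells := fun r => if r is R0 then map Some w else [::].
have xs : represents x (Store w [::] [::] [::]).
  by case; exists 0; rewrite /= ?cats0.
have [x' Hr xs'] := fruns_exec H xs.
pose T : {ffun 'I_4 -> tape tm} := ctapes (init tm w).
have HT : tapes_of T x.
  by case; rewrite /T /init /= ffunE /=; split; try (by exists 0);
     rewrite // -map_comp; apply: eq_map.
have [T' HT' E] := tm_runs Hr HT.
have ET : init tm w = @Config _ tm (inl (entry c)) T by [].
rewrite /outcome iterS ET E /step /= ffunE.
by rewrite (read_tapes_of R0 HT') to_symK (scan_represents R0 xs').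
Qed.

End Compile.

(** * Runs within a time bound *)

Definition runs (c : cmd) (s s' : store) (T : nat) : Prop :=
  exists2 t, t <= T & exec c s s' t.

Lemma runs_le (c : cmd) (s s' : store) (T T' : nat) :
  T <= T' -> runs c s s' T -> runs c s s' T'.
Proof. by move=> H [t Ht E]; exists t => //; apply: leq_trans H. Qed.

Lemma runs_push (r : reg) (a : sgn) (s : store) :
  runs (Push r a) s (put s r (a :: content s r)) 2.
Proof. by exists 2 => //; constructor. Qed.

Lemma runs_pop (r : reg) (s : store) :
  runs (Pop r) s (put s r (behead (content s r))) 1.
Proof. by exists 1 => //; constructor. Qed.

Lemma runs_seq (c1 c2 : cmd) (s s1 s2 : store) (T1 T2 : nat) :
  runs c1 s s1 T1 -> runs c2 s1 s2 T2 -> runs (Seq c1 c2) s s2 (T1 + T2).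
Proof.
move=> [t1 H1 E1] [t2 H2 E2]; exists (t1 + t2); last exact: ExecSeq E1 E2.
exact: leq_add.
Qed.

Lemma runs_if (r : reg) (p : option sgn -> bool) (c1 c2 : cmd)
    (s s' : store) (T : nat) :
  runs (if p (ohead (content s r)) then c1 else c2) s s' T ->
  runs (If r p c1 c2) s s' T.+1.
Proof.
by case Ep: (p _) => -[t H E]; exists t.+1 => //;
  [apply: ExecIfTrue | apply: ExecIfFalse].
Qed.

Lemma runs_while0 (r : reg) (p : option sgn -> bool) (c : cmd) (s : store) :
  p (ohead (content s r)) = false -> runs (While r p c) s s 1.
Proof. by exists 1 => //; constructor. Qed.

Lemma runs_while (r : reg) (p : option sgn -> bool) (c : cmd)
    (s s1 s2 : store) (T1 T2 : nat) :
  p (ohead (content s r)) -> runs c s s1 T1 -> runs (While r p c) s1 s2 T2 ->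
  runs (While r p c) s s2 (T1 + T2).+1.
Proof.
move=> Ep [t1 H1 E1] [t2 H2 E2]; exists (t1 + t2).+1.
  by rewrite ltnS leq_add.
exact: ExecWhileTrue Ep E1 E2.
Qed.

Ltac straight :=
  eapply runs_le; last by
    (repeat first [ eapply runs_seq | apply: runs_push | apply: runs_pop ]);
  by [].

(** * Moving, copying and comparing trees in prefix notation *)

Inductive tree := Leaf | Node of tree & tree.

Fixpoint tbits (t : tree) : seq bool :=
  if t is Node a b then true :: tbits a ++ tbits b else [:: false].

Fixpoint tree_size (t : tree) : nat :=
  if t is Node a b then (tree_size a + tree_size b).+1 else 1.

Lemma size_tbits (t : tree) : size (tbits t) = tree_size t.
Proof. by elim: t => //= a <- b <-; rewrite size_cat. Qed.

Lemma tree_size_gt0 (t : tree) : 0 < tree_size t.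
Proof. by case: t. Qed.

Definition raw (s : seq bool) : seq sgn := map Some s.

Definition some_top (o : option sgn) : bool := isSome o.
Definition is1 (o : option sgn) : bool := o == Some (Some true).

Definition mv_bit (src dst : reg) : cmd :=
  If src is1 (Seq (Pop src) (Push dst (Some true)))
             (Seq (Pop src) (Push dst (Some false))).

Definition pour (src dst : reg) : cmd := While src some_top (mv_bit src dst).

Lemma mv_bitP (src dst : reg) (x : bool) (s : store) (l : seq sgn) :
  content s src = Some x :: l ->
  runs (mv_bit src dst) s
    (put (put s src l) dst (Some x :: content (put s src l) dst)) 4.
Proof.
move=> E; apply: runs_if; rewrite E.
have -> : l = behead (content s src) by rewrite E.
by case: x E => E /=; straight.
Qed.

Lemma pour10 (l : seq bool) (a b c : seq sgn) :
  runs (pour R1 R0) (Store a (raw l) b c) (Store (raw (rev l) ++ a) [::] b c)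
    (5 * size l + 1).
Proof.
elim: l a => [|x l IH] a; first exact: runs_while0.
rewrite rev_cons /raw map_rcons cat_rcons.
apply: (@runs_le _ _ _ (4 + (5 * size l + 1)).+1); first by rewrite /=; lia.
apply: runs_while (IH _) => //; exact: mv_bitP.
Qed.

Lemma pour30 (l : seq bool) (a b c : seq sgn) :
  runs (pour R3 R0) (Store a b c (raw l)) (Store (raw (rev l) ++ a) b c [::])
    (5 * size l + 1).
Proof.
elim: l a => [|x l IH] a; first exact: runs_while0.
rewrite rev_cons /raw map_rcons cat_rcons.
apply: (@runs_le _ _ _ (4 + (5 * size l + 1)).+1); first by rewrite /=; lia.
apply: runs_while (IH _) => //; exact: mv_bitP.
Qed.

Lemma pour31 (l : seq bool) (a b c : seq sgn) :
  runs (pour R3 R1) (Store a b c (raw l)) (Store a (raw (rev l) ++ b) c [::])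
    (5 * size l + 1).
Proof.
elim: l b => [|x l IH] b; first exact: runs_while0.
rewrite rev_cons /raw map_rcons cat_rcons.
apply: (@runs_le _ _ _ (4 + (5 * size l + 1)).+1); first by rewrite /=; lia.
apply: runs_while (IH _) => //; exact: mv_bitP.
Qed.

(* The number of ticks on [R2] is the number of subtrees still to be read. *)
Definition tick : cmd := Push R2 None.

Definition count_bit : cmd := If R0 is1 tick (Pop R2).

Definition scan_tree (body : cmd) : cmd :=
  Seq tick (While R2 some_top (Seq count_bit body)).


Section ScanTree.
Variables (body : cmd) (S : seq sgn -> seq sgn -> seq bool -> store).
Hypothesis S0 : forall K C l, content (S K C l) R0 = K.
Hypothesis S2 : forall K C l, content (S K C l) R2 = C.
Hypothesis S2put : forall K C l C', put (S K C l) R2 C' = S K C' l.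
Hypothesis bodyP : forall K C l x,
  runs body (S (Some x :: K) C l) (S K C (x :: l)) 4.

Let loop := While R2 some_top (Seq count_bit body).

(** The rest of the run after the subtree is a hypothesis, so the induction hypotheses for the two
    subtrees of a node can be chained. Each bit costs 8: the loop test, at most 3 for the count and
    4 for the body. The abstract [S] lets moving to [R1], moving to [R3] and dropping share this
    proof. *)
Lemma scan_loopP (t : tree) (K C : seq sgn) (l : seq bool) (s' : store)
    (T : nat) :
  runs loop (S K C (catrev (tbits t) l)) s' T ->
  runs loop (S (raw (tbits t) ++ K) (None :: C) l) s' (8 * tree_size t + T).
Proof.
elim: t K C l T => [|a IHa b IHb] K C l T H /=.
  apply: (@runs_le _ _ _ ((3 + 4) + T).+1); first lia.
  apply: runs_while H; first by rewrite S2.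
  apply: runs_seq; last exact: bodyP.
  apply: (@runs_le _ _ _ 2) => //; apply: runs_if; rewrite S0 /=.
  have := runs_pop R2 (S (Some false :: K) (None :: C) l).
  rewrite S2 S2put /= => H'; exact: H'.
apply: (@runs_le _ _ _ ((3 + 4) + (8 * tree_size a + (8 * tree_size b + T))).+1).
  by lia.
rewrite /raw map_cat -catA.
have H1 : runs loop (S (raw (tbits a) ++ raw (tbits b) ++ K)
    (None :: None :: C) (true :: l)) s' (8 * tree_size a + (8 * tree_size b + T)).
  by apply: IHa; apply: IHb; move: H; rewrite /= !catrevE rev_cat catA.
apply: runs_while H1; first by rewrite S2.
  apply: runs_seq; last exact: bodyP.
  apply: runs_if; rewrite S0 /=.
  set K' := Some true :: _; have := runs_push R2 None (S K' (None :: C) l).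
  rewrite S2 S2put /= => H'; exact: H'.
Qed.

Lemma scan_treeP (t : tree) (K : seq sgn) (l : seq bool) :
  runs (scan_tree body) (S (raw (tbits t) ++ K) [::] l)
    (S K [::] (catrev (tbits t) l)) (8 * tree_size t + 3).
Proof.
apply: (@runs_le _ _ _ (2 + (8 * tree_size t + 1))); first lia.
apply: runs_seq; first exact: runs_push.
rewrite S2 S2put; apply: scan_loopP; apply: runs_while0.
by rewrite S2.
Qed.

End ScanTree.

Definition tstack (t : tree) (K : seq sgn) : seq sgn := raw (tbits t) ++ K.

Definition st0 (K : seq sgn) : store := Store K [::] [::] [::].

Definition take_tree (dst : reg) : cmd := scan_tree (mv_bit R0 dst).

Lemma take1P (t : tree) (K a : seq sgn) :
  runs (take_tree R1) (Store (tstack t K) [::] [::] a)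
    (Store K (raw (rev (tbits t))) [::] a) (8 * tree_size t + 3).
Proof.
pose S K C l := Store K (raw l) C a.
apply: (@scan_treeP (mv_bit R0 R1) S _ _ _ _ t K [::]) => // K' C l x.
exact: (@mv_bitP R0 R1 x (S (Some x :: K') C l)).
Qed.

Lemma take3P (t : tree) (K a : seq sgn) :
  runs (take_tree R3) (Store (tstack t K) a [::] [::])
    (Store K a [::] (raw (rev (tbits t)))) (8 * tree_size t + 3).
Proof.
pose S K C l := Store K a C (raw l).
apply: (@scan_treeP (mv_bit R0 R3) S _ _ _ _ t K [::]) => // K' C l x.
exact: (@mv_bitP R0 R3 x (S (Some x :: K') C l)).
Qed.

Definition drop_tree : cmd := scan_tree (Pop R0).

Lemma dropP (t : tree) (K : seq sgn) :
  runs drop_tree (st0 (tstack t K)) (st0 K) (8 * tree_size t + 3).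
Proof.
pose S K C (l : seq bool) := Store K [::] C [::].
apply: (@scan_treeP (Pop R0) S _ _ _ _ t K [::]) => // K' C l x.
by apply: runs_le (runs_pop R0 _).
Qed.

Definition swap_tree : cmd :=
  Seq (take_tree R1) (Seq (take_tree R3) (Seq (pour R1 R0) (pour R3 R0))).

Lemma swapP (t u : tree) (K : seq sgn) :
  runs swap_tree (st0 (tstack t (tstack u K))) (st0 (tstack u (tstack t K)))
    (13 * (tree_size t + tree_size u) + 8).
Proof.
apply: (@runs_le _ _ _ ((8 * tree_size t + 3) + ((8 * tree_size u + 3) +
  ((5 * tree_size t + 1) + (5 * tree_size u + 1))))); first lia.
apply: runs_seq; first exact: take1P.
apply: runs_seq; first exact: take3P.
rewrite -(size_tbits t) -(size_tbits u) -!(size_rev (tbits _)).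
apply: runs_seq; first exact: pour10.
by rewrite revK; have := pour30 (rev (tbits u)) (tstack t K) [::] [::];
  rewrite revK.
Qed.

Definition split1 : cmd :=
  While R1 some_top
    (If R1 is1
      (Seq (Pop R1) (Seq (Push R0 (Some true)) (Push R3 (Some true))))
      (Seq (Pop R1) (Seq (Push R0 (Some false)) (Push R3 (Some false))))).

Lemma split1P (l : seq bool) (a b c : seq sgn) :
  runs split1 (Store a (raw l) b c)
    (Store (raw (rev l) ++ a) [::] b (raw (rev l) ++ c)) (7 * size l + 1).
Proof.
elim: l a c => [|x l IH] a c; first exact: runs_while0.
rewrite rev_cons /raw map_rcons !cat_rcons.
apply: (@runs_le _ _ _ (6 + (7 * size l + 1)).+1); first by rewrite /=; lia.
apply: runs_while (IH _ _) => //.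
by case: x; apply: runs_if => /=; apply: (@runs_le _ _ _ (1 + (2 + 2))) => //;
  straight.
Qed.

(** After the split both copies read forward; two further pours, each a reversal, carry the copy on
    [R3] over to [R0] in the same orientation. *)
Definition dup_tree : cmd :=
  Seq (take_tree R1) (Seq split1 (Seq (pour R3 R1) (pour R1 R0))).

Lemma dupP (t : tree) (K : seq sgn) :
  runs dup_tree (st0 (tstack t K)) (st0 (tstack t (tstack t K)))
    (25 * tree_size t + 6).
Proof.
apply: (@runs_le _ _ _ ((8 * tree_size t + 3) + ((7 * tree_size t + 1) +
  ((5 * tree_size t + 1) + (5 * tree_size t + 1))))); first lia.
apply: runs_seq; first exact: take1P.
rewrite -(size_tbits t) -!(size_rev (tbits _)).
apply: runs_seq; first exact: split1P.
rewrite revK cats0 size_rev.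
apply: runs_seq; first exact: pour31.
rewrite cats0 -(size_rev (tbits t)).
by have := pour10 (rev (tbits t)) (tstack t K) [::] [::]; rewrite revK.
Qed.

(** [R2] collects one tick per mismatch. As it may be nonempty, the idle branch pushes and pops a
    tick instead of only popping. *)
Definition flag_if (r : reg) (p : option sgn -> bool) : cmd :=
  If r p tick (Seq tick (Pop R2)).

Definition compare_loop1 : cmd :=
  While R1 some_top
    (Seq (If R1 is1 (flag_if R3 (fun o => o != Some (Some true)))
                    (flag_if R3 (fun o => o != Some (Some false))))
         (Seq (Pop R1) (Pop R3))).

Definition compare_loop3 : cmd := While R3 some_top (Seq (Pop R3) tick).

Definition compare13 : cmd := Seq compare_loop1 compare_loop3.

Lemma flag_ifP (r : reg) (p : option sgn -> bool) (s : store) :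
  runs (flag_if r p) s
    (if p (ohead (content s r)) then put s R2 (None :: content s R2) else s) 4.
Proof.
case Ep: (p _).
  by apply: (@runs_le _ _ _ 3) => //; apply: runs_if; rewrite Ep; apply: runs_push.
apply: runs_if; rewrite Ep.
case: s {Ep} => a b c d.
exact: (@runs_seq _ _ _ _ _ 2 1 (runs_push _ _ _) (runs_pop _ _)).
Qed.

(** The loop is driven by [l] alone; an exhausted [m] counts as a mismatch. It thus decides only
    whether [l] is a prefix of [m], and the remainder of [m] is left to [compare_loop3]. *)
Lemma compare_loop1P (l m : seq bool) (a C : seq sgn) :
  exists C',
    [/\ runs compare_loop1 (Store a (raw l) C (raw m))
         (Store a [::] C' (raw (drop (size l) m))) (8 * size l + 1),
        nilp C' = nilp C && prefix l m & size C' <= size C + size l].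
Proof.
elim: l m C => [|x l IH] m C.
  exists C; split; first by rewrite drop0; apply: runs_while0.
    by rewrite prefix0s andbT.
  by rewrite addn0.
pose C1 := if ohead m != Some x then None :: C else C.
have [C2 [H1 H2 H3]] := IH (behead m) C1.
exists C2; split; last 1 first.
- by move: H3; rewrite /C1; case: ifP => _ /=; lia.
- apply: (@runs_le _ _ _ ((5 + (1 + 1)) + (8 * size l + 1)).+1).
    by rewrite /=; lia.
  have -> : drop (size (x :: l)) m = drop (size l) (behead m) by case: (m).
  apply: runs_while H1 => //; have -> : raw (behead m) = behead (raw m) by case: (m).
  apply: (@runs_seq _ _ _ (Store a (raw (x :: l)) C1 (raw m))); last first.
    exact: (@runs_seq _ _ _ _ _ 1 1 (runs_pop _ _) (runs_pop _ _)).
  apply: runs_if; rewrite /C1.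
  have -> : ohead m != Some x = (ohead (raw m) != Some (Some x)).
    by case: (m) => //= y m'; rewrite !(inj_eq Some_inj).
  have := flag_ifP R3 (fun o => o != Some (Some x))
    (Store a (raw (x :: l)) C (raw m)).
  by case: (x) => /=; case: ifP.
rewrite H2 /C1; case: m {IH H1 H3 H2 C1 C2} => [|y m] /=.
  by rewrite !andbF.
rewrite (inj_eq Some_inj) eq_sym; case: (x == y) => //=.
by rewrite !andbF.
Qed.

Lemma compare13P (l m : seq bool) (a : seq sgn) :
  exists C',
    [/\ runs compare13 (Store a (raw l) [::] (raw m)) (Store a [::] C' [::])
         (8 * (size l + size m) + 2),
        nilp C' = (l == m) & size C' <= size l + size m].
Proof.
have run3 m1 C1 : exists C2,
    [/\ runs compare_loop3 (Store a [::] C1 (raw m1)) (Store a [::] C2 [::])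
         (4 * size m1 + 1),
        nilp C2 = nilp C1 && nilp m1 & size C2 <= size C1 + size m1].
  elim: m1 C1 => [|y m1 IH] C1.
    exists C1; split; first exact: runs_while0.
    - by rewrite andbT.
    - by rewrite addn0.
  have [C2 [H1 H2 H3]] := IH (None :: C1).
  exists C2; split; last by move: H3 => /=; lia.
    apply: (@runs_le _ _ _ (3 + (4 * size m1 + 1)).+1); first by rewrite /=; lia.
    by apply: runs_while H1 => //; apply: (@runs_seq _ _ _ _ _ 1 2); straight.
  by rewrite H2 /= andbF.
have [C1 [H1 H2 H3]] := compare_loop1P l m a [::].
have [C2 [H4 H5 H6]] := run3 (drop (size l) m) C1.
have Hd : size (drop (size l) m) <= size m by rewrite size_drop leq_subr.
exists C2; split.
- apply: (@runs_le _ _ _ ((8 * size l + 1) + (4 * size (drop (size l) m) + 1))).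
    by lia.
  exact: runs_seq H1 H4.
- rewrite H5 H2 /=; elim: (l) m {H1 H2 H3 H4 H5 H6 Hd} => [|x l' IH] [|y m] //=.
  by rewrite -andbA IH.
- by move: H3 => /=; lia.
Qed.

Definition clear2 : cmd := While R2 some_top (Pop R2).

Lemma clear2P (a b c d : seq sgn) (n : nat) :
  all some_top (map Some c) -> size c <= n ->
  runs clear2 (Store a b c d) (Store a b [::] d) (2 * n + 1).
Proof.
elim: c n => [|x c IH] n /=; first by move=> _ _; apply: runs_le (runs_while0 _ _) => //; lia.
case: n => // n Hc; rewrite ltnS => Hn.
apply: (@runs_le _ _ _ (1 + (2 * n + 1)).+1); first lia.
by apply: runs_while (IH _ Hc Hn) => //; apply: runs_pop.
Qed.

Definition btree (b : bool) : tree := if b then Node Leaf Leaf else Leaf.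

Definition eq_tree : cmd :=
  Seq (take_tree R1) (Seq (take_tree R3) (Seq compare13
    (If R2 some_top (Seq clear2 (Push R0 (Some false)))
       (Seq (Push R0 (Some false)) (Seq (Push R0 (Some false))
         (Push R0 (Some true))))))).

Lemma eqP_tree (t u : tree) (K : seq sgn) :
  runs eq_tree (st0 (tstack t (tstack u K)))
    (st0 (tstack (btree (tbits t == tbits u)) K))
    (18 * (tree_size t + tree_size u) + 20).
Proof.
have [C [H1 H2 H3]] := compare13P (rev (tbits t)) (rev (tbits u)) K.
rewrite !size_rev !size_tbits in H1 H3.
have -> : (tbits t == tbits u) = nilp C.
  by rewrite H2 (can_eq (@revK _)).
apply: (@runs_le _ _ _ ((8 * tree_size t + 3) + ((8 * tree_size u + 3) +
  ((8 * (tree_size t + tree_size u) + 2) +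
   ((2 * (tree_size t + tree_size u) + 1) + 6).+1)))); first lia.
apply: runs_seq; first exact: take1P.
apply: runs_seq; first exact: take3P.
apply: runs_seq; first exact: H1.
apply: runs_if => /=; case: C H1 H2 H3 => [|x C] H1 H2 H3 /=.
  by apply: (@runs_le _ _ _ (2 + (2 + 2))); [lia | straight].
apply: (@runs_le _ _ _ ((2 * (tree_size t + tree_size u) + 1) + 2)); first lia.
apply: runs_seq; first by apply: clear2P H3; rewrite all_map; apply/allP.
exact: runs_push.
Qed.

Lemma tbits_prefix (t u : tree) (r s : seq bool) :
  tbits t ++ r = tbits u ++ s -> t = u /\ r = s.
Proof.
elim: t u r s => [|a IHa b IHb] [|c d] r s //=; first by case.
by case; rewrite -!catA => /IHa[-> /IHb[-> ->]].
Qed.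

Lemma tbits_inj : injective tbits.
Proof.
by move=> t u E; have [] := @tbits_prefix t u [::] [::]; rewrite // !cats0.
Qed.

(** * Data types coded by trees *)

Class coded (T : Type) := Coded { code : T -> tree; code_inj : injective code }.

#[global] Instance coded_tree : coded tree := @Coded tree id (fun _ _ => id).

#[global] Instance coded_unit : coded unit.
Proof. by exists (fun _ => Leaf); case; case. Defined.

Lemma btree_inj : injective btree.
Proof. by case; case. Qed.

#[global] Instance coded_bool : coded bool := Coded btree_inj.

Section CodePair.
Context {A B : Type} {cA : coded A} {cB : coded B}.

Definition code_pair (x : A * B) : tree := Node (code x.1) (code x.2).

Lemma code_pair_inj : injective code_pair.
Proof. by case=> a b [c d] [] /= /(@code_inj A cA) -> /(@code_inj B cB) ->. Qed.

End CodePair.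

#[global] Instance coded_pair (A B : Type) (cA : coded A) (cB : coded B) :
  coded (A * B) := Coded code_pair_inj.

Section CodeSeq.
Context {A : Type} {cA : coded A}.

Definition code_seq (s : seq A) : tree :=
  foldr (fun a t => Node (code a) t) Leaf s.

Lemma code_seq_inj : injective code_seq.
Proof.
by elim=> [|a s IH] [|b t] //= [] /(@code_inj A cA) -> /IH ->.
Qed.

End CodeSeq.

#[global] Instance coded_seq (A : Type) (cA : coded A) : coded (seq A) :=
  Coded code_seq_inj.

Definition csize {A : Type} {cA : coded A} (a : A) : nat := tree_size (code a).

Lemma csize_gt0 {A : Type} {cA : coded A} (a : A) : 0 < csize a.
Proof. exact: tree_size_gt0. Qed.

Lemma csize_pair {A B : Type} {cA : coded A} {cB : coded B} (a : A) (b : B) :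
  csize (a, b) = (csize a + csize b).+1.
Proof. by []. Qed.

Lemma csize_cons {A : Type} {cA : coded A} (a : A) (s : seq A) :
  csize (a :: s) = (csize a + csize s).+1.
Proof. by []. Qed.

Lemma size_le_csize {A : Type} {cA : coded A} (s : seq A) : size s < csize s.
Proof.
by elim: s => //= a s IH; rewrite csize_cons; have := csize_gt0 a; lia.
Qed.

Lemma csize_drop {A : Type} {cA : coded A} (i : nat) (s : seq A) :
  csize (drop i s) <= csize s.
Proof.
elim: s i => [|a s IH] [|i] //=; rewrite csize_cons.
by have := IH i; lia.
Qed.

(** * Polynomial bounds in the size of the code of the argument *)

(** The base is at least 2, so constants and sums are absorbed by raising the exponent, and no
    polynomials have to be manipulated. *)
Definition pbound {A : Type} {cA : coded A} (g : A -> nat) : Prop :=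
  exists k, forall a, g a <= (csize a).+1 ^ k.

Lemma leq_expl (m n e : nat) : m <= n -> m ^ e <= n ^ e.
Proof. by case: e => // e H; rewrite leq_exp2r. Qed.

Section PBound.
Context {A : Type} {cA : coded A}.

Lemma pbound_le (g h : A -> nat) :
  (forall a, g a <= h a) -> pbound h -> pbound g.
Proof. by move=> gh [k H]; exists k => a; apply: leq_trans (gh a) (H a). Qed.

Lemma pbound_csize : pbound (fun a : A => csize a).
Proof. by exists 1 => a; rewrite expn1. Qed.

Lemma pbound_cst (n : nat) : pbound (fun _ : A => n).
Proof.
exists n => a; apply: leq_trans (ltnW (ltn_expl n (isT : 1 < 2))) _.
by rewrite leq_expl ?ltnS ?csize_gt0.
Qed.

Lemma pbound_mul (g h : A -> nat) :
  pbound g -> pbound h -> pbound (fun a => g a * h a).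
Proof. by move=> [k Hg] [l Hh]; exists (k + l) => a; rewrite expnD leq_mul. Qed.

Lemma pbound_add (g h : A -> nat) :
  pbound g -> pbound h -> pbound (fun a => g a + h a).
Proof.
move=> [k Hg] [l Hh]; exists (k + l).+1 => a; set b := (csize a).+1.
have b2 : 1 < b by rewrite ltnS csize_gt0.
have b0 : 0 < b by lia.
have H1 : g a <= b ^ (k + l).
  by apply: leq_trans (Hg a) _; rewrite leq_pexp2l ?leq_addr.
have H2 : h a <= b ^ (k + l).
  by apply: leq_trans (Hh a) _; rewrite leq_pexp2l ?leq_addl.
by rewrite expnS; apply: leq_trans (leq_mul b2 (leqnn _)); lia.
Qed.

Lemma pbound_exp (g : A -> nat) (n : nat) :
  pbound g -> pbound (fun a => g a ^ n).
Proof.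
by move=> [k H]; exists (k * n) => a; rewrite expnM leq_expl.
Qed.

Lemma pbound_comp {B : Type} {cB : coded B} (f : A -> B) (g : B -> nat) :
  pbound (fun a => csize (f a)) -> pbound g -> pbound (fun a => g (f a)).
Proof.
move=> Hf [k Hg]; apply: (@pbound_le _ (fun a => (csize (f a) + 1) ^ k)).
  by move=> a; rewrite addn1.
exact/pbound_exp/pbound_add/pbound_cst.
Qed.

End PBound.

Ltac pbound :=
  repeat first
    [ exact: pbound_csize | exact: pbound_cst | assumption
    | apply: pbound_add | apply: pbound_mul | apply: pbound_exp ].

(** * Functions computed by polynomial-time commands *)

(** The argument is replaced in place on top of an arbitrary rest [K], with the other stacks empty
    before and after; this is what makes commands composable and allows data to be parked below. *)
Definition polyf {A B : Type} {cA : coded A} {cB : coded B} (f : A -> B) :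
    Prop :=
  exists c g, pbound g /\ forall a K,
    runs c (st0 (tstack (code a) K)) (st0 (tstack (code (f a)) K)) (g a).

(** The output outgrows the input by at most the running time. Composition relies on this, since the
    second time bound is taken at the output of the first function. *)
Lemma pbound_polyf {A B : Type} {cA : coded A} {cB : coded B} (f : A -> B) :
  polyf f -> pbound (fun a => csize (f a)).
Proof.
move=> [c [g [pg H]]].
apply: (@pbound_le _ _ _ (fun a => csize a + g a)); last by pbound.
move=> a; have [t Ht E] := H a [::].
have := exec_size R0 E; rewrite /= /tstack !cats0 !size_map !size_tbits.
by rewrite /csize; lia.
Qed.

Lemma polyf_ext {A B : Type} {cA : coded A} {cB : coded B} (f h : A -> B) :
  f =1 h -> polyf f -> polyf h.
Proof.
by move=> E [c [g [pg H]]]; exists c, g; split=> // a K; rewrite -E.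
Qed.

(* There is no empty command; [Pop R2] is a no-op on an empty stack. *)
Lemma polyf_recode {A B : Type} {cA : coded A} {cB : coded B} (f : A -> B) :
  (forall a, code (f a) = code a) -> polyf f.
Proof.
move=> E; exists (Pop R2), (fun _ => 1); split; first by pbound.
by move=> a K; rewrite E; apply: runs_pop.
Qed.

Lemma polyf_id {A : Type} {cA : coded A} : polyf (fun a : A => a).
Proof. exact: polyf_recode. Qed.

Lemma polyf_comp {A B C : Type} {cA : coded A} {cB : coded B} {cC : coded C}
    (f : A -> B) (h : B -> C) :
  polyf h -> polyf f -> polyf (fun a => h (f a)).
Proof.
move=> [c2 [g2 [p2 H2]]] Hf; have pf := pbound_polyf Hf.
case: Hf => [c1 [g1 [p1 H1]]]; exists (Seq c1 c2), (fun a => g1 a + g2 (f a)).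
split; first by apply: pbound_add => //; apply: pbound_comp.
by move=> a K; apply: runs_seq (H1 _ _) (H2 _ _).
Qed.

Fixpoint push_bits (l : seq bool) : cmd :=
  if l is b :: l' then Seq (push_bits l') (Push R0 (Some b)) else Pop R2.

Lemma push_bitsP (l : seq bool) (K b d : seq sgn) :
  runs (push_bits l) (Store K b [::] d) (Store (raw l ++ K) b [::] d)
    (2 * size l + 1).
Proof.
elim: l => [|x l IH]; first exact: runs_pop.
apply: (@runs_le _ _ _ ((2 * size l + 1) + 2)); first by rewrite /=; lia.
exact: runs_seq IH (runs_push _ _ _).
Qed.

Lemma polyf_cst {A B : Type} {cA : coded A} {cB : coded B} (b : B) :
  polyf (fun _ : A => b).
Proof.
exists (Seq drop_tree (push_bits (tbits (code b)))).
exists (fun a => (8 * csize a + 3) + (2 * size (tbits (code b)) + 1)).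
split; first by pbound.
by move=> a K; apply: runs_seq (dropP _ _) (push_bitsP _ _ _ _).
Qed.

Section Pairs.
Context {A B C : Type} {cA : coded A} {cB : coded B} {cC : coded C}.

Lemma polyf_pair (f : A -> B) (h : A -> C) :
  polyf f -> polyf h -> polyf (fun a => (f a, h a)).
Proof.
move=> Hf Hh; have [pf ph] := (pbound_polyf Hf, pbound_polyf Hh).
case: Hf Hh => [c1 [g1 [p1 H1]]] [c2 [g2 [p2 H2]]].
exists (Seq dup_tree (Seq c1 (Seq swap_tree (Seq c2 (Seq swap_tree
  (Push R0 (Some true))))))).
exists (fun a => (25 * csize a + 6) + (g1 a +
  ((13 * (csize (f a) + csize a) + 8) + (g2 a +
   ((13 * (csize (h a) + csize (f a)) + 8) + 2))))).
split; first by pbound.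
move=> a K; apply: runs_seq; first exact: dupP.
apply: runs_seq; first exact: H1.
apply: runs_seq; first exact: swapP.
apply: runs_seq; first exact: H2.
apply: runs_seq; first exact: swapP.
apply: runs_le (leqnn _) _.
have -> : st0 (tstack (code (f a, h a)) K) =
    put (st0 (tstack (code (f a)) (tstack (code (h a)) K))) R0
     (Some true :: tstack (code (f a)) (tstack (code (h a)) K)).
  by rewrite /tstack /= /raw map_cat catA.
exact: runs_push.
Qed.

Lemma polyf_fst (f : A -> B * C) : polyf f -> polyf (fun a => (f a).1).
Proof.
apply: polyf_comp.
exists (Seq (Pop R0) (Seq swap_tree drop_tree)).
exists (fun a => 1 + ((13 * csize a + 8) + (8 * csize a + 3))).
split; first by pbound.
case=> b c K; apply: runs_seq; first exact: runs_pop.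
rewrite /= /raw map_cat -catA csize_pair.
apply: (@runs_le _ _ _ ((13 * (csize b + csize c) + 8) + (8 * csize c + 3))).
  by lia.
by apply: runs_seq (swapP _ _ _) (dropP _ _).
Qed.

Lemma polyf_snd (f : A -> B * C) : polyf f -> polyf (fun a => (f a).2).
Proof.
apply: polyf_comp.
exists (Seq (Pop R0) drop_tree), (fun a => 1 + (8 * csize a + 3)).
split; first by pbound.
case=> b c K; apply: runs_seq; first exact: runs_pop.
rewrite /= /raw map_cat -catA csize_pair.
apply: (@runs_le _ _ _ (8 * csize b + 3)); first lia.
exact: dropP.
Qed.

End Pairs.

Lemma polyf_eqtree {A B : Type} {cA : coded A} {cB : coded B} (f h : A -> B) :
  polyf f -> polyf h -> polyf (fun a => tbits (code (f a)) == tbits (code (h a))).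
Proof.
move=> Hf Hh.
apply: (@polyf_comp _ (B * B) bool _ _ _ (fun a => (f a, h a))
  (fun p => tbits (code p.1) == tbits (code p.2))); last exact: polyf_pair.
exists (Seq (Pop R0) eq_tree), (fun a => 1 + (18 * csize a + 20)).
split; first by pbound.
case=> b c K; apply: runs_seq; first exact: runs_pop.
rewrite /= /raw map_cat -catA csize_pair.
apply: (@runs_le _ _ _ (18 * (csize b + csize c) + 20)); first lia.
exact: eqP_tree.
Qed.

Lemma polyf_eq {A : Type} {B : eqType} {cA : coded A} {cB : coded B}
    (f h : A -> B) :
  polyf f -> polyf h -> polyf (fun a => f a == h a).
Proof.
move=> Hf Hh; apply: polyf_ext (polyf_eqtree Hf Hh) => a /=.
by apply/eqP/eqP => [/tbits_inj/(@code_inj B cB)|->].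
Qed.

(* Booleans, lists and trees are all analysed by testing for a leaf; [U] is the
   type of the data carried by a node. *)
Lemma polyf_branch {A T U B : Type} {cA : coded A} {cT : coded T}
    {cU : coded U} {cB : coded B} (f : A -> T) (h g0 : A -> B)
    (g1 : A * U -> B) :
  (forall a, (code (f a) = Leaf /\ h a = g0 a) \/
     exists u, [/\ code (f a) = code u, code u <> Leaf & h a = g1 (a, u)]) ->
  polyf f -> polyf g0 -> polyf g1 -> polyf h.
Proof.
move=> E Hf [c0 [b0 [p0 H0]]] [c1 [b1 [p1 H1]]].
have pf := pbound_polyf Hf; case: Hf => [c [b [p H]]].
have [k Hk] := p1.
exists (Seq dup_tree (Seq c (If R0 is1
  (Seq swap_tree (Seq (Push R0 (Some true)) c1)) (Seq drop_tree c0)))).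
exists (fun a => (25 * csize a + 6) + (b a +
  ((13 * (csize (f a) + csize a) + 8) +
   (2 + ((csize a + csize (f a) + 2) ^ k)) + (8 * csize (f a) + 3) + b0 a + 1))).
split; first by pbound.
move=> a K; apply: runs_seq; first exact: dupP.
apply: runs_seq; first exact: H.
have [[Ef ->]|[u [Ef Hu ->]]] := E a.
  apply: (@runs_le _ _ _ ((8 * csize (f a) + 3) + b0 a).+1); first lia.
  apply: runs_if; rewrite {1}Ef /=.
  by apply: runs_seq (dropP _ _) (H0 _ _).
rewrite /csize Ef -!/(csize _).
apply: (@runs_le _ _ _ ((13 * (csize u + csize a) + 8) +
   (2 + b1 (a, u))).+1).
  have : b1 (a, u) <= (csize a + csize u + 2) ^ k.
    by rewrite addn2; exact: Hk (a, u).
  by move: (_ ^ k) => ?; lia.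
apply: runs_if; have -> : is1 (ohead (content (st0 (tstack (code u)
   (tstack (code a) K))) R0)) by case: (code u) Hu.
apply: runs_seq; first exact: swapP.
apply: runs_seq; first exact: runs_push.
by have := H1 (a, u) K; rewrite /tstack /= /raw map_cat -catA; apply.
Qed.

Lemma polyf_if {A B : Type} {cA : coded A} {cB : coded B} (f : A -> bool)
    (g h : A -> B) :
  polyf f -> polyf g -> polyf h -> polyf (fun a => if f a then g a else h a).
Proof.
move=> Hf Hg Hh.
apply: (@polyf_branch A bool (unit * unit) B _ _ _ _ f _ h (fun p => g p.1)) => //.
  move=> a; case: (f a); last by left.
  by right; exists (tt, tt).
exact: polyf_comp Hg (polyf_fst polyf_id).
Qed.

Lemma polyf_match {A X B : Type} {cA : coded A} {cX : coded X} {cB : coded B}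
    (f : A -> seq X) (g : A -> B) (h : A -> X -> seq X -> B) :
  polyf f -> polyf g ->
  polyf (fun p : A * (X * seq X) => h p.1 p.2.1 p.2.2) ->
  polyf (fun a => match f a with [::] => g a | x :: l => h a x l end).
Proof.
move=> Hf Hg Hh.
apply: (@polyf_branch A (seq X) (X * seq X) B _ _ _ _ f _ g _ _ Hf Hg Hh) => a.
case: (f a) => [|x l]; first by left.
by right; exists (x, l).
Qed.

Lemma polyf_cons {A X : Type} {cA : coded A} {cX : coded X} (f : A -> X)
    (g : A -> seq X) : polyf f -> polyf g -> polyf (fun a => f a :: g a).
Proof.
move=> Hf Hg.
apply: (@polyf_comp A (X * seq X) (seq X) _ _ _ (fun a => (f a, g a))
   (fun p => p.1 :: p.2)); last exact: polyf_pair.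
by apply: polyf_recode; case.
Qed.

(** * Bounded iteration *)

Section Iter.
Context {A B X : Type} {cA : coded A} {cB : coded B} {cX : coded X}.

Definition iter_cmd (c : cmd) : cmd :=
  While R0 is1 (Seq (Pop R0) (Seq drop_tree (Seq swap_tree
    (Seq c swap_tree)))).

(** Cost of one round, loop test included, when [N] bounds the remaining counter list, [M] the
    iterated value, and the body takes [(M + 1) ^ k]. *)
Definition iter_cost (k N M : nat) : nat :=
  1 + ((8 * N + 3) + ((13 * (N + M) + 8) + ((M + 1) ^ k +
    (13 * (N + M) + 8)))) + 1.

Lemma iter_cmdP (step : B -> B) (c : cmd) (g : B -> nat) (k N M : nat)
    (s : seq X) (b : B) (K : seq sgn) :
  (forall b K, runs c (st0 (tstack (code b) K))
                      (st0 (tstack (code (step b)) K)) (g b)) ->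
  (forall b, g b <= (csize b).+1 ^ k) ->
  csize s <= N -> (forall i, i <= size s -> csize (iter i step b) <= M) ->
  runs (iter_cmd c) (st0 (tstack (code s) (tstack (code b) K)))
    (st0 (tstack Leaf (tstack (code (iter (size s) step b)) K)))
    (size s * iter_cost k N M + 1).
Proof.
move=> H Hg; elim: s b => [|x s IH] b HN HM; first exact: runs_while0.
rewrite csize_cons in HN.
have M0 : csize b <= M by apply: (HM 0).
have M1 : csize (step b) <= M by apply: (HM 1).
have IH' := IH (step b) _ _.
have -> : size (x :: s) = (size s).+1 by [].
rewrite iterSr.
apply: (@runs_le _ _ _ (((1 + ((8 * csize x + 3) + ((13 * (csize s + csize b) + 8)
   + (g b + (13 * (csize (step b) + csize s) + 8)))))) +
   (size s * iter_cost k N M + 1)).+1).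
  have : g b <= (M + 1) ^ k.
    by apply: leq_trans (Hg b) _; rewrite addn1 leq_expl.
  rewrite [_.+1 * iter_cost _ _ _]mulSn; move: (size s * _) => Q; rewrite /iter_cost.
  by move: ((M + 1) ^ k) => P; lia.
apply: runs_while; first by []; last first.
  apply: IH'; first lia.
  by move=> i Hi; rewrite -iterSr; apply: HM.
apply: runs_seq; first exact: runs_pop.
rewrite /= /raw map_cat -catA.
apply: runs_seq; first exact: dropP.
apply: runs_seq; first exact: swapP.
apply: runs_seq; first exact: H.
exact: swapP.
Qed.

(** The list [n a] serves as a unary clock. A polynomial step could square the size of its argument
    in every round, so the bound [S] on all intermediate values is a hypothesis of its own. *)
Lemma polyf_iter (step : B -> B) (n : A -> seq X) (init : A -> B)
    (S : A -> nat) :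
  polyf step -> polyf n -> polyf init -> pbound S ->
  (forall a i, i <= size (n a) -> csize (iter i step (init a)) <= S a) ->
  polyf (fun a => iter (size (n a)) step (init a)).
Proof.
move=> [c [g [[k Hg] H]]] Hn Hi pS HS.
have pn := pbound_polyf Hn.
have [c1 [g1 [p1 H1]]] := polyf_pair Hn Hi.
exists (Seq c1 (Seq (Pop R0) (Seq (iter_cmd c) (Pop R0)))).
exists (fun a => g1 a + (1 + (csize (n a) * iter_cost k (csize (n a)) (S a) + 1
  + 1))).
split; first by rewrite /iter_cost; pbound.
move=> a K; apply: runs_seq; first exact: H1.
apply: runs_seq; first exact: runs_pop.
rewrite /= /raw map_cat -catA.
apply: runs_seq; last exact: (runs_pop R0 (st0 (tstack Leaf (tstack _ K)))).
apply: (@runs_le _ _ _ (size (n a) * iter_cost k (csize (n a)) (S a) + 1)).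
  by rewrite leq_add2r leq_mul2r (ltnW (size_le_csize _)) orbT.
by apply: iter_cmdP => // i; apply: HS.
Qed.

End Iter.

Lemma polyf_app2 {A B C D : Type} {cA : coded A} {cB : coded B} {cC : coded C}
    {cD : coded D} (g : B -> C -> D) (f1 : A -> B) (f2 : A -> C) :
  polyf (fun p : B * C => g p.1 p.2) -> polyf f1 -> polyf f2 ->
  polyf (fun a => g (f1 a) (f2 a)).
Proof.
by move=> Hg H1 H2; apply: (polyf_comp (f := fun a => (f1 a, f2 a)) Hg);
  apply: polyf_pair.
Qed.

Lemma polyf_app3 {A B C D E : Type} {cA : coded A} {cB : coded B}
    {cC : coded C} {cD : coded D} {cE : coded E} (g : B -> C -> D -> E)
    (f1 : A -> B) (f2 : A -> C) (f3 : A -> D) :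
  polyf (fun p : B * (C * D) => g p.1 p.2.1 p.2.2) ->
  polyf f1 -> polyf f2 -> polyf f3 ->
  polyf (fun a => g (f1 a) (f2 a) (f3 a)).
Proof.
by move=> Hg H1 H2 H3;
  apply: (polyf_comp (f := fun a => (f1 a, (f2 a, f3 a))) Hg);
  do 2 apply: polyf_pair => //.
Qed.

Section Fold.
Context {A B X : Type} {cA : coded A} {cB : coded B} {cX : coded X}.

Definition fold_step (g : A -> B -> X -> B) (q : A * (seq X * B)) :
    A * (seq X * B) :=
  match q.2.1 with
  | [::] => q
  | x :: l => (q.1, (l, g q.1 q.2.2 x))
  end.

Lemma iter_fold_step (g : A -> B -> X -> B) (a : A) (s : seq X) (b : B) i :
  i <= size s ->
  iter i (fold_step g) (a, (s, b)) =
    (a, (drop i s, foldl (g a) b (take i s))).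
Proof.
elim: i => [|i IH] Hi; first by rewrite drop0 take0.
rewrite iterS IH; last exact: ltnW.
have [x0 _] : exists x0 : X, true by case: s Hi {IH} => // x0; exists x0.
by rewrite /fold_step /= (drop_nth x0 Hi) (take_nth x0 Hi) foldl_rcons.
Qed.

(* The growth [w] must not depend on the accumulator, so that the accumulator
   stays polynomially bounded throughout the loop. *)
Lemma polyf_foldl (g : A -> B -> X -> B) (s : A -> seq X) (init : A -> B)
    (w : A * X -> nat) :
  polyf (fun p : A * (B * X) => g p.1 p.2.1 p.2.2) -> polyf s -> polyf init ->
  pbound w -> (forall a b x, csize (g a b x) <= csize b + w (a, x)) ->
  polyf (fun a => foldl (g a) (init a) (s a)).
Proof.
move=> Hg Hs Hi [k Hw] Hgrow.
have [ps pi] := (pbound_polyf Hs, pbound_polyf Hi).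
(* [W a] bounds [w (a, x)] for every [x] in the list; of the 2, one is the node of the pair and one
   the successor in [pbound]. *)
pose W a := (@csize A cA a + @csize _ (coded_seq cX) (s a) + 2) ^ k.
have HW a i : i <= size (s a) ->
    csize (foldl (g a) (init a) (take i (s a))) <= csize (init a) + i * W a.
  elim: i => [|i IH] Hi'; first by rewrite take0 addn0.
  have [x0 _] : exists x0 : X, true by case: (s a) Hi' => // x0; exists x0.
  rewrite (take_nth x0 Hi') foldl_rcons.
  have H1 : csize (nth x0 (s a) i) < csize (s a).
    elim: (s a) i Hi' {IH} => // y l IH [|i] Hi'; rewrite csize_cons /=.
      by have := @csize_gt0 _ _ l; lia.
    by have := IH i Hi'; lia.
  have H2 : w (a, nth x0 (s a) i) <= W a.
    by apply: leq_trans (Hw _) _; rewrite csize_pair leq_expl //; lia.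
  have := Hgrow a (foldl (g a) (init a) (take i (s a))) (nth x0 (s a) i).
  by have := IH (ltnW Hi'); rewrite mulSn; move: (i * W a) => ?; lia.
apply: (@polyf_ext _ _ _ _ (fun a => (iter (size (s a)) (fold_step g)
  (a, (s a, init a))).2.2)).
  by move=> a; rewrite iter_fold_step //= take_size.
apply/polyf_snd/polyf_snd.
apply: (@polyf_iter _ _ _ _ _ _ _ _ _
  (fun a => csize a + csize (s a) + (csize (init a) + csize (s a) * W a) + 2)).
- apply: polyf_match.
  + exact/polyf_fst/polyf_snd/polyf_id.
  + exact: polyf_id.
  apply: polyf_pair; first exact/polyf_fst/polyf_fst/polyf_id.
  apply: polyf_pair; first exact/polyf_snd/polyf_snd/polyf_id.
  apply: (polyf_app3 Hg).
  + exact/polyf_fst/polyf_fst/polyf_id.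
  + exact/polyf_snd/polyf_snd/polyf_fst/polyf_id.
  + exact/polyf_fst/polyf_snd/polyf_id.
- exact: Hs.
- by apply: polyf_pair polyf_id (polyf_pair Hs Hi).
- by rewrite /W; pbound.
move=> a i Hi'; rewrite iter_fold_step // !csize_pair.
have := HW a i Hi'; have : csize (drop i (s a)) <= csize (s a).
  exact: csize_drop.
have : i * W a <= csize (s a) * W a.
  by rewrite leq_mul2r (leq_trans Hi' (ltnW (size_le_csize _))) orbT.
 by cbn beta; move: (csize (s a) * W a) (i * W a) => ? ?; lia.
Qed.

End Fold.

(** * List operations and boolean connectives *)

Lemma csize_bool (b : bool) : csize b <= 3.
Proof. by case: b. Qed.

Section Lists.
Context {A X Y : Type} {cA : coded A} {cX : coded X} {cY : coded Y}.

Lemma polyf_rev (s : A -> seq X) : polyf s -> polyf (fun a => rev (s a)).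
Proof.
move=> Hs; apply: (@polyf_ext _ _ _ _
   (fun a => foldl (fun r x => x :: r) [::] (s a))).
  by move=> a; rewrite -[rev _]/(catrev _ [::]); elim: (s a) [::] => //=.
apply: (@polyf_foldl _ _ _ _ _ _ (fun _ r x => x :: r) _ _
  (fun p => (csize p).+1)) => //.
- apply: polyf_cons; first exact/polyf_snd/polyf_snd/polyf_id.
  exact/polyf_fst/polyf_snd/polyf_id.
- exact: polyf_cst.
- by apply: pbound_le (pbound_add pbound_csize (pbound_cst 1)) => a; rewrite addn1.
- by move=> a b x; rewrite csize_cons /= csize_pair; lia.
Qed.

End Lists.

Section Lists2.
Context {A X Y : Type} {cA : coded A} {cX : coded X} {cY : coded Y}.

Lemma polyf_foldr (g : A -> X -> Y -> Y) (s : A -> seq X) (init : A -> Y)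
    (w : A * X -> nat) :
  polyf (fun p : A * (Y * X) => g p.1 p.2.2 p.2.1) -> polyf s -> polyf init ->
  pbound w -> (forall a b x, csize (g a x b) <= csize b + w (a, x)) ->
  polyf (fun a => foldr (g a) (init a) (s a)).
Proof.
move=> Hg Hs Hi pw Hw; apply: (@polyf_ext _ _ _ _
   (fun a => foldl (fun b x => g a x b) (init a) (rev (s a)))).
  by move=> a; rewrite foldl_rev.
apply: (@polyf_foldl _ _ _ _ _ _ (fun a b x => g a x b) _ _ w) => //.
exact: polyf_rev.
Qed.

Lemma polyf_map (f : A -> X -> Y) (s : A -> seq X) :
  polyf (fun p : A * X => f p.1 p.2) -> polyf s ->
  polyf (fun a => map (f a) (s a)).
Proof.
move=> Hf Hs.
apply: (@polyf_ext _ _ _ _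
   (fun a => rev (foldl (fun r x => f a x :: r) [::] (s a)))).
  move=> a; suff H r : foldl (fun r x => f a x :: r) r (s a) =
      catrev (map (f a) (s a)) r by rewrite H -[catrev _ _]/(rev _) revK.
  by elim: (s a) r => //=.
have pf := pbound_polyf Hf; apply: polyf_rev.
apply: (@polyf_foldl _ _ _ _ _ _ (fun a r x => f a x :: r) _ _
  (fun p => csize (f p.1 p.2) + 1)) => //.
- apply: polyf_cons; last exact/polyf_fst/polyf_snd/polyf_id.
  apply: (polyf_app2 Hf); first exact/polyf_fst/polyf_id.
  exact/polyf_snd/polyf_snd/polyf_id.
- exact: polyf_cst.
- by pbound.
- by move=> a b x; rewrite csize_cons /=; lia.
Qed.

Lemma polyf_all (f : A -> X -> bool) (s : A -> seq X) :
  polyf (fun p : A * X => f p.1 p.2) -> polyf s ->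
  polyf (fun a => all (f a) (s a)).
Proof.
move=> Hf Hs.
apply: (@polyf_ext _ _ _ _
   (fun a => foldl (fun b x => if f a x then b else false) true (s a))).
  move=> a; suff H b : foldl (fun b x => if f a x then b else false) b (s a) =
      b && all (f a) (s a) by rewrite H.
  elim: (s a) b => [|x l IH] b /=; first by rewrite andbT.
  by rewrite IH; case: (f a x); rewrite //= andbF.
apply: (@polyf_foldl _ _ _ _ _ _ (fun a b x => if f a x then b else false) _ _
  (fun p => 3)) => //.
- apply: polyf_if; last exact: polyf_cst.
    apply: (polyf_app2 Hf); first exact/polyf_fst/polyf_id.
    exact/polyf_snd/polyf_snd/polyf_id.
  exact/polyf_fst/polyf_snd/polyf_id.
- exact: polyf_cst.
- exact: pbound_cst.
- by move=> a b x; have := csize_bool (if f a x then b else false); lia.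
Qed.

End Lists2.

Section Booleans.
Context {A : Type} {cA : coded A}.
Implicit Types f g : A -> bool.

Lemma polyf_negb f : polyf f -> polyf (fun a => ~~ f a).
Proof.
move=> Hf; apply: (@polyf_ext _ _ _ _ (fun a => if f a then false else true)).
  by move=> a; case: (f a).
by apply: polyf_if => //; apply: polyf_cst.
Qed.

Lemma polyf_andb f g : polyf f -> polyf g -> polyf (fun a => f a && g a).
Proof. by move=> Hf Hg; apply: polyf_if => //; apply: polyf_cst. Qed.

Lemma polyf_orb f g : polyf f -> polyf g -> polyf (fun a => f a || g a).
Proof. by move=> Hf Hg; apply: polyf_if => //; apply: polyf_cst. Qed.

Lemma polyf_implb f g : polyf f -> polyf g -> polyf (fun a => f a ==> g a).
Proof. by move=> Hf Hg; apply: polyf_if => //; apply: polyf_cst. Qed.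

End Booleans.

Section MoreLists.
Context {A X : Type} {cA : coded A} {cX : coded X}.

Lemma polyf_has (f : A -> X -> bool) (s : A -> seq X) :
  polyf (fun p : A * X => f p.1 p.2) -> polyf s ->
  polyf (fun a => has (f a) (s a)).
Proof.
move=> Hf Hs; apply: (@polyf_ext _ _ _ _ (fun a => ~~ all (fun x => ~~ f a x) (s a))).
  by move=> a; rewrite -has_predC; apply: eq_has => x /=; rewrite negbK.
apply: polyf_negb; apply: (@polyf_all _ _ _ _ (fun a x => ~~ f a x)) => //.
exact: polyf_negb.
Qed.

Lemma polyf_cat (s t : A -> seq X) :
  polyf s -> polyf t -> polyf (fun a => s a ++ t a).
Proof.
move=> Hs Ht; apply: (@polyf_ext _ _ _ _
   (fun a => foldr (fun x r => x :: r) (t a) (s a))).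
  by move=> a; elim: (s a) => //= x l ->.
apply: (@polyf_foldr A X (seq X) _ _ _ (fun _ x r => x :: r) _ _
  (fun p => csize p + 1)) => //.
- apply: polyf_cons; first exact/polyf_snd/polyf_snd/polyf_id.
  exact/polyf_fst/polyf_snd/polyf_id.
- by pbound.
- by move=> a b x; rewrite csize_cons /= csize_pair; lia.
Qed.

End MoreLists.

Lemma csize_cat {X : Type} {cX : coded X} (s t : seq X) :
  (csize (s ++ t)).+1 = csize s + csize t.
Proof. by elim: s => //= x s IH; rewrite !csize_cons; lia. Qed.

Lemma polyf_flatten {A X : Type} {cA : coded A} {cX : coded X}
    (s : A -> seq (seq X)) :
  polyf s -> polyf (fun a => flatten (s a)).
Proof.
move=> Hs.
apply: (@polyf_foldr A (seq X) (seq X) _ _ _ (fun _ => cat) _ _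
  (fun p => csize p)) => //.
- by apply: polyf_cat; [exact/polyf_snd/polyf_snd/polyf_id|
     exact/polyf_fst/polyf_snd/polyf_id].
- exact: polyf_cst.
- exact: pbound_csize.
- by move=> a b x; have := @csize_cat _ cX x b; rewrite csize_pair; lia.
Qed.

Lemma polyf_mem {A : Type} {X : eqType} {cA : coded A} {cX : coded X}
    (f : A -> X) (s : A -> seq X) :
  polyf f -> polyf s -> polyf (fun a => f a \in s a).
Proof.
move=> Hf Hs; apply: (@polyf_ext _ _ _ _ (fun a => has (fun x => x == f a) (s a))).
  by move=> a; rewrite has_pred1.
apply: (@polyf_has _ _ _ _ (fun a x => x == f a)) => //.
apply: polyf_eq; first exact/polyf_snd/polyf_id.
exact/(polyf_comp Hf)/polyf_fst/polyf_id.
Qed.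

Ltac polyf_step :=
  first
    [ exact: polyf_id | assumption | exact: polyf_cst
    | apply: polyf_fst | apply: polyf_snd | apply: polyf_pair
    | apply: polyf_andb | apply: polyf_orb | apply: polyf_negb
    | apply: polyf_implb | apply: polyf_if | apply: polyf_mem | apply: polyf_eq
    | apply: polyf_cons | apply: polyf_cat | apply: polyf_flatten
    | apply: polyf_all; cbn beta | apply: polyf_has; cbn beta
    | apply: polyf_map; cbn beta | apply: polyf_rev ].

Ltac polyf := repeat polyf_step.

(** * Formulas as token lists in Polish notation *)

Fixpoint bits_pos (s : seq bool) : positive :=
  match s with
  | [::] | [:: _] => xH
  | false :: s' => xO (bits_pos s')
  | true :: s' => xI (bits_pos s')
  end.

Definition bits_nat (s : seq bool) : nat :=
  if last true s && (s != [::]) then nat_of_bin (Npos (bits_pos s)) else 0.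

(* A list of bits encodes a number iff it is empty or its last, most
   significant, bit is set. *)
Lemma bits_natK (s : seq bool) :
  nat_bits (bits_nat s) = if last true s then s else [::].
Proof.
rewrite /bits_nat; case: s => [|b s] //; rewrite andbT.
case: ifP => // Hl; rewrite /nat_bits nat_of_binK.
elim: s b Hl => [|c s IH] b /=; first by move=> ->.
by move/(IH c) => <-; case: b.
Qed.

Lemma nat_bitsK : cancel nat_bits bits_nat.
Proof.
move=> n; rewrite -[RHS](bin_of_natK n) /nat_bits.
case: (bin_of_nat n) => [//|p].
have Hp : last true (pos_bits p) && (pos_bits p != [::]).
  by elim: p => //= p; case: (pos_bits p) => [|b s]; rewrite /= ?andbF ?andbT.
rewrite /bits_nat Hp; congr (nat_of_bin (Npos _)).
have ne q : exists b s, pos_bits q = b :: s.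
  by case: q => [q|q|] /=; do 2 eexists.
by elim: p {Hp} => //= p; have [b [s ->]] := ne p => /= ->.
Qed.

Notation tok := (seq bool * seq bool)%type.

Definition op_var := [:: false; false; false].
Definition op_top := [:: false; false; true].
Definition op_bot := [:: false; true; false].
Definition op_neg := [:: false; true; true].
Definition op_and := [:: true; false; false].
Definition op_or := [:: true; false; true].
Definition op_imp := [:: true; true; false].
Definition op_iff := [:: true; true; true].

(** Iteration runs along lists, so recursion over formulas is replaced by a fold over tokens. The
    second component carries the digits of a variable and is empty for the other symbols. *)
Fixpoint toks (f : formula) : seq tok :=
  match f with
  | Var n => [:: (op_var, nat_bits n)]
  | Top => [:: (op_top, [::])]
  | Bot => [:: (op_bot, [::])]
  | Neg a => (op_neg, [::]) :: toks a
  | And a b => (op_and, [::]) :: toks a ++ toks b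
  | Or a b => (op_or, [::]) :: toks a ++ toks b
  | Imp a b => (op_imp, [::]) :: toks a ++ toks b
  | Iff a b => (op_iff, [::]) :: toks a ++ toks b
  end.

(* Reading the tokens from right to left evaluates a formula with a stack. *)
Section TokStep.
Variables (V : Type) (var : seq bool -> V) (top bot : V) (neg : V -> V).
Variable bin : seq bool -> V -> V -> V.

Definition tok_step (t : tok) (s : seq V) : seq V :=
  if t.1 == op_var then var t.2 :: s else
  if t.1 == op_top then top :: s else
  if t.1 == op_bot then bot :: s else
  match s with
  | [::] => [::]
  | a :: s' =>
      if t.1 == op_neg then neg a :: s' else
      match s' with
      | [::] => [::]
      | b :: s'' => bin t.1 a b :: s''
      end
  end.

Fixpoint interp (f : formula) : V :=
  match f with
  | Var n => var (nat_bits n)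
  | Top => top
  | Bot => bot
  | Neg a => neg (interp a)
  | And a b => bin op_and (interp a) (interp b)
  | Or a b => bin op_or (interp a) (interp b)
  | Imp a b => bin op_imp (interp a) (interp b)
  | Iff a b => bin op_iff (interp a) (interp b)
  end.

Lemma foldr_tok_step (f : formula) (s : seq V) :
  foldr tok_step s (toks f) = interp f :: s.
Proof.
by elim: f s => //= [a IHa|a IHa b IHb|a IHa b IHb|a IHa b IHb|a IHa b IHb] s;
  rewrite ?foldr_cat ?IHb ?IHa.
Qed.

Lemma csize_tok_step {cV : coded V} (w : nat) (t : tok) (s : seq V) :
  csize (var t.2) <= w -> csize top <= w -> csize bot <= w ->
  (forall a, csize (neg a) <= csize a + w) ->
  (forall a b, csize (bin t.1 a b) <= csize a + csize b + w) ->
  csize (tok_step t s) <= csize s + w.+1.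
Proof.
move=> Hv Ht Hb Hn Hbin; rewrite /tok_step.
do 3 (case: ifP => _; first by rewrite csize_cons; lia).
case: s => [|a s]; first lia.
case: ifP => _; first by rewrite !csize_cons; have := Hn a; lia.
case: s => [|b s]; first by rewrite !csize_cons; lia.
by rewrite !csize_cons; have := Hbin a b; lia.
Qed.

End TokStep.

Lemma polyf_tok_step {A V : Type} {cA : coded A} {cV : coded V}
    (var : A -> seq bool -> V) (top bot : V) (neg : V -> V)
    (bin : seq bool -> V -> V -> V) :
  polyf (fun p : A * seq bool => var p.1 p.2) -> polyf neg ->
  polyf (fun p : seq bool * (V * V) => bin p.1 p.2.1 p.2.2) ->
  polyf (fun p : A * (seq V * tok) =>
    tok_step (var p.1) top bot neg bin p.2.2 p.2.1).
Proof.
move=> Hv Hn Hb; rewrite /tok_step.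
apply: polyf_if; first by polyf.
  by apply: polyf_cons; [apply: (polyf_app2 Hv); polyf | polyf].
do 2 (apply: polyf_if; [by polyf | by polyf | ]).
apply: polyf_match; [by polyf | by polyf | ].
apply: polyf_if; first by polyf.
  by apply: polyf_cons; [apply: (polyf_comp Hn); polyf | polyf].
apply: polyf_match; [by polyf | by polyf | ].
by apply: polyf_cons; [apply: (polyf_app3 Hb); polyf | polyf].
Qed.

Definition bin_formula (op : seq bool) : formula -> formula -> formula :=
  if op == op_and then And else if op == op_or then Or else
  if op == op_imp then Imp else Iff.

Definition parse_toks (l : seq tok) : formula :=
  head Top (foldr (tok_step (fun s => Var (bits_nat s)) Top Bot Neg bin_formula)
                  [::] l).

Lemma toksK : cancel toks parse_toks.
Proof.
move=> f; rewrite /parse_toks foldr_tok_step /=.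
by elim: f => //= [n|a ->|a -> b ->|a -> b ->|a -> b ->|a -> b ->] //;
  rewrite nat_bitsK.
Qed.

#[global] Instance coded_formula : coded formula :=
  @Coded formula (fun f => code (toks f))
    (inj_comp (@code_inj (seq tok) _) (can_inj toksK)).

Lemma polyf_toks {A : Type} {cA : coded A} (f : A -> formula) :
  polyf f -> polyf (fun a => toks (f a)).
Proof. by apply: polyf_comp; apply: polyf_recode. Qed.

Definition var_toks (s : seq bool) : seq tok :=
  [:: (op_var, if last true s then s else [::])].

Definition bin_toks (op : seq bool) (a b : seq tok) : seq tok :=
  (if op == op_and then op_and else if op == op_or then op_or else
   if op == op_imp then op_imp else op_iff, [::]) :: a ++ b.

Definition toks_step : tok -> seq (seq tok) -> seq (seq tok) :=
  tok_step var_toks [:: (op_top, [::])] [:: (op_bot, [::])]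
    (cons (op_neg, [::])) bin_toks.

Definition toks_of_toks (l : seq tok) : seq tok :=
  head [:: (op_top, [::])] (foldr toks_step [::] l).

(** A formula is stored as its tokens, so computing the parser means normalising an arbitrary token
    list: noncanonical digits, unknown operators and missing operands all get the tokens of whatever
    formula results from the defaults. *)
Lemma toks_parse_toks (l : seq tok) : toks (parse_toks l) = toks_of_toks l.
Proof.
rewrite /parse_toks /toks_of_toks.
set stepF := tok_step _ _ _ _ _.
suff : map toks (foldr stepF [::] l) = foldr toks_step [::] l.
  by move=> <-; case: (foldr _ _ _).
elim: l => //= -[op s] l <-; move: (foldr _ _ _) => st.
rewrite /stepF /toks_step /tok_step /=.
case: ifP => _; first by rewrite /= /var_toks bits_natK.
do 2 (case: ifP => // _); case: st => [|a st] //=; case: ifP => // _.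
case: st => [|b st] //=; rewrite /bin_formula /bin_toks.
by do 3 (case: ifP => // _).
Qed.

(** A valuation is sent as the list of its true variables, each named by its binary digits. *)
Definition vmem (v : seq (seq bool)) (n : nat) : bool := nat_bits n \in v.

Definition bin_bool (op : seq bool) (a b : bool) : bool :=
  if op == op_and then a && b else if op == op_or then a || b else
  if op == op_imp then a ==> b else a == b.

Lemma polyf_eval {A : Type} {cA : coded A} (v : A -> seq (seq bool))
    (f : A -> formula) :
  polyf v -> polyf f -> polyf (fun a => eval (vmem (v a)) (f a)).
Proof.
move=> Hv Hf.
pose step (w : seq (seq bool)) :=
  tok_step (fun s => s \in w) true false negb bin_bool.
apply: (@polyf_app2 _ _ _ _ _ _ _ _ (fun w f => eval (vmem w) f)) => //.
apply: (@polyf_ext _ _ _ _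
   (fun p => head false (foldr (step p.1) [::] (toks p.2)))).
  case=> w g /=; rewrite foldr_tok_step /=.
  by elim: g => //= [a ->|a -> b ->|a -> b ->|a -> b ->|a -> b ->].
rewrite /head; apply: polyf_match; [ | exact: polyf_cst | polyf].
(* A boolean has size at most 3, and its list cell adds one. *)
apply: (@polyf_foldr _ _ _ _ _ _ (fun p t st => step p.1 t st) _ _ (fun=> 4)).
- apply: (@polyf_app2 _ _ _ _ _ _ _ _ (fun w q =>
    tok_step (fun s => s \in w) true false negb bin_bool q.2 q.1)).
  + apply: (@polyf_tok_step _ _ _ _ (fun w s => s \in w)).
    * by polyf.
    * by polyf.
    * by rewrite /bin_bool; polyf.
  + by polyf.
  + by polyf.
- by apply: polyf_toks; polyf.
- by polyf.
- exact: pbound_cst.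
- move=> p b t; apply: csize_tok_step; try exact: csize_bool.
    by move=> a; apply: leq_trans (csize_bool _) _; rewrite leq_addl.
  by move=> a b'; apply: leq_trans (csize_bool _) _; rewrite leq_addl.
Qed.

Lemma polyf_toks_of_toks {A : Type} {cA : coded A} (s : A -> seq tok) :
  polyf s -> polyf (fun a => toks_of_toks (s a)).
Proof.
apply: polyf_comp; rewrite /toks_of_toks /head.
apply: polyf_match; [ | exact: polyf_cst | by polyf].
apply: (@polyf_foldr _ _ _ _ _ _ (fun _ => toks_step) _ _
   (fun p => csize p + 30)).
- apply: (polyf_tok_step (A := seq tok) (var := fun _ => var_toks)).
  + apply: polyf_cons; [apply: polyf_pair; first by polyf | by polyf].
    apply: polyf_if; [ | by polyf | by polyf].
    apply: (@polyf_ext _ _ _ _ (fun p : seq tok * seq bool =>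
      head true (rev p.2))).
      by move=> p; case/lastP: p.2 => // l x; rewrite last_rcons rev_rcons.
    by rewrite /head; apply: polyf_match; polyf.
  + by polyf.
  + by rewrite /bin_toks; polyf.
- by polyf.
- by polyf.
- by pbound.
- move=> p st [op bs].
  have E1 : csize ([::] : seq bool) = 1 by [].
  have E2 : csize ([::] : seq tok) = 1 by [].
  (* Three bits of size at most 3, a node for each, and the final leaf: 3 * 4 + 1 = 13. *)
  have Hop (o : seq bool) : o \in [:: op_var; op_top; op_bot; op_neg; op_and; op_or; op_imp;
      op_iff] -> csize o <= 13.
    by move=> Ho; apply/(allP (a := fun o : seq bool => csize o <= 13)): o Ho.
  apply: leq_trans (csize_tok_step (w := csize (op, bs) + 29) _ _ _ _ _ _) _.
  + rewrite /var_toks csize_cons !csize_pair E2 [(_, _).2]/=.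
    have : csize (if last true bs then bs else [::]) <= csize bs.
      by case: ifP => // _; rewrite E1 csize_gt0.
    by have := Hop op_var isT; lia.
  + exact: leq_trans (leq_addl _ _).
  + exact: leq_trans (leq_addl _ _).
  + by move=> a; rewrite (_ : csize _ = (13 + csize a).+1) //; lia.
  + move=> a b; rewrite /bin_toks csize_cons.
    have : (csize (a ++ b)).+1 = csize a + csize b by exact: csize_cat.
    set o := if _ then _ else _.
    have : csize o <= 13 by apply: Hop; rewrite /o; do 3 (case: ifP => // _).
    have : csize (o, [::] : seq bool) = (csize o + 1).+1 by [].
    lia.
  + by cbn beta; rewrite (csize_pair p); lia.
Qed.

(** * Decoding bit strings *)

(** The moves of the players are arbitrary strings, so decoding has to be total and itself
    computable in polynomial time; its values matter only on genuine codes. *)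
Class decodable (T : Type) (cT : coded T) := Decodable {
  dec : tree -> T;
  decK : cancel (@code T cT) dec;
  polyf_dec : polyf dec
}.

#[global] Instance decodable_bool : decodable coded_bool.
Proof.
exists (fun t => if t is Node _ _ then true else false); first by case.
apply: (@polyf_branch _ tree (tree * tree) _ _ _ _ _ id _ (fun=> false)
   (fun=> true)); try by polyf.
by case=> [|a b]; [left | right; exists (a, b)].
Defined.

Definition split_tree (t : tree) : tree * tree :=
  if t is Node a b then (a, b) else (Leaf, Leaf).

Lemma polyf_split_tree : polyf split_tree.
Proof.
apply: (@polyf_branch _ tree (tree * tree) _ _ _ _ _ id _ (fun=> (Leaf, Leaf))
   snd); try by polyf.
by case=> [|a b]; [left | right; exists (a, b)].
Qed.

#[global] Instance decodable_pair (A B : Type) (cA : coded A) (cB : coded B)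
  (dA : decodable cA) (dB : decodable cB) : decodable (coded_pair cA cB).
Proof.
exists (fun t => (@dec A cA dA (split_tree t).1, @dec B cB dB (split_tree t).2)).
  by case=> a b /=; rewrite !decK.
by apply: polyf_pair; [apply: (polyf_comp (@polyf_dec _ _ dA)) |
  apply: (polyf_comp (@polyf_dec _ _ dB))];
  [apply: polyf_fst | apply: polyf_snd]; exact: polyf_split_tree.
Defined.

Fixpoint spine (t : tree) : seq tree :=
  if t is Node a b then a :: spine b else [::].

#[global] Instance decodable_seq (A : Type) (cA : coded A) (dA : decodable cA) :
  decodable (coded_seq cA).
Proof.
exists (fun t => map (@dec A cA dA) (spine t)).
  by elim=> //= a s ->; rewrite decK.
apply: polyf_map.
  by apply: (polyf_comp (@polyf_dec _ _ dA)); polyf.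
by apply: polyf_recode; elim=> //= a _ b ->.
Defined.

#[global] Instance decodable_formula : decodable coded_formula.
Proof.
exists (fun t => parse_toks (dec t)).
  by move=> f; rewrite [code f]/(code (toks f)) decK toksK.
apply: (@polyf_comp _ (seq tok)); last exact: polyf_dec.
(* The command that normalises tokens already computes the parsed formula, whose code is the code of
   its tokens. *)
have [c [g [pg H]]] := polyf_toks_of_toks (@polyf_id (seq tok) _).
by exists c, g; split=> // l K; have := H l K; rewrite -toks_parse_toks.
Defined.

Definition default_of (p : formula * (seq formula * formula)) : default :=
  Default p.1 p.2.1 p.2.2.

Definition of_default (d : default) : formula * (seq formula * formula) :=
  (prereq d, (justs d, concl d)).

Lemma of_defaultK : cancel of_default default_of.
Proof. by case. Qed.

#[global] Instance coded_default : coded default :=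
  @Coded default (fun d => code (of_default d))
    (inj_comp (@code_inj (formula * (seq formula * formula)) _)
      (can_inj of_defaultK)).

#[global] Instance decodable_default : decodable coded_default.
Proof.
exists (fun t => default_of (dec t)).
  by move=> d; rewrite [code d]/(code (of_default d)) decK of_defaultK.
apply: (@polyf_comp _ (formula * (seq formula * formula))).
  by apply: polyf_recode; case=> a [b c].
exact: polyf_dec.
Defined.

Definition instance_of
    (p : seq default * (seq formula * (seq (default * default) * formula))) :
    instance :=
  Instance p.1 p.2.1 p.2.2.1 p.2.2.2.

Definition of_instance (x : instance) :
    seq default * (seq formula * (seq (default * default) * formula)) :=
  (defaults x, (facts x, (priority x, query x))).

Lemma of_instanceK : cancel of_instance instance_of.
Proof. by case. Qed.

#[global] Instance coded_instance : coded instance :=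
  @Coded instance (fun d => code (of_instance d))
    (inj_comp (@code_inj
      (seq default * (seq formula * (seq (default * default) * formula))) _)
      (can_inj of_instanceK)).

#[global] Instance decodable_instance : decodable coded_instance.
Proof.
exists (fun t => instance_of (dec t)).
  by move=> d; rewrite [code d]/(code (of_instance d)) decK of_instanceK.
apply: (@polyf_comp _
  (seq default * (seq formula * (seq (default * default) * formula)))).
  by apply: polyf_recode; case=> a [b [c d]].
exact: polyf_dec.
Defined.

Section Projections.
Context {A : Type} {cA : coded A}.

Lemma polyf_of_default (f : A -> default) :
  polyf f -> polyf (fun a => of_default (f a)).
Proof. by apply: polyf_comp; apply: polyf_recode. Qed.

Lemma polyf_prereq (f : A -> default) :
  polyf f -> polyf (fun a => prereq (f a)).
Proof. by move/polyf_of_default; exact: polyf_fst. Qed.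

Lemma polyf_justs (f : A -> default) :
  polyf f -> polyf (fun a => justs (f a)).
Proof. by move/polyf_of_default/polyf_snd; exact: polyf_fst. Qed.

Lemma polyf_concl (f : A -> default) :
  polyf f -> polyf (fun a => concl (f a)).
Proof. by move/polyf_of_default/polyf_snd; exact: polyf_snd. Qed.

Lemma polyf_of_instance (f : A -> instance) :
  polyf f -> polyf (fun a => of_instance (f a)).
Proof. by apply: polyf_comp; apply: polyf_recode. Qed.

Lemma polyf_defaults (f : A -> instance) :
  polyf f -> polyf (fun a => defaults (f a)).
Proof. by move/polyf_of_instance; exact: polyf_fst. Qed.

Lemma polyf_facts (f : A -> instance) :
  polyf f -> polyf (fun a => facts (f a)).
Proof. by move/polyf_of_instance/polyf_snd; exact: polyf_fst. Qed.

Lemma polyf_priority (f : A -> instance) :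
  polyf f -> polyf (fun a => priority (f a)).
Proof. by move/polyf_of_instance/polyf_snd/polyf_snd; exact: polyf_fst. Qed.

Lemma polyf_query (f : A -> instance) :
  polyf f -> polyf (fun a => query (f a)).
Proof. by move/polyf_of_instance/polyf_snd/polyf_snd; exact: polyf_snd. Qed.

End Projections.

Definition tree_step (b : bool) (s : seq tree) : seq tree :=
  if b then
    match s with
    | [::] => [::]
    | t :: s' => match s' with [::] => [::] | u :: s'' => Node t u :: s'' end
    end
  else Leaf :: s.

Definition to_bits {T : Type} {cT : coded T} (x : T) : seq bool :=
  tbits (code x).

(** Every string decodes to something: a node bit that finds fewer than two trees empties the stack,
    and [Leaf] stands in for a missing tree. *)
Definition of_bits {T : Type} {cT : coded T} {dT : decodable cT}
    (s : seq bool) : T :=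
  dec (head Leaf (foldr tree_step [::] s)).

Lemma foldr_tree_step (t : tree) (s : seq tree) :
  foldr tree_step s (tbits t) = t :: s.
Proof. by elim: t s => //= a IHa b IHb s; rewrite foldr_cat IHb IHa. Qed.

Lemma to_bitsK {T : Type} {cT : coded T} {dT : decodable cT} :
  cancel (@to_bits T cT) of_bits.
Proof. by move=> x; rewrite /of_bits foldr_tree_step /= decK. Qed.

Lemma polyf_of_bits {A T : Type} {cA : coded A} {cT : coded T}
    {dT : decodable cT} (s : A -> seq bool) :
  polyf s -> polyf (fun a => of_bits (s a) : T).
Proof.
move=> Hs; apply: (polyf_comp (@polyf_dec _ _ dT)); rewrite /head.
apply: polyf_match; [ | by polyf | by polyf].
apply: (@polyf_foldr _ _ _ _ _ _ (fun _ => tree_step) _ _ (fun=> 2)) => //.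
- rewrite /tree_step; apply: polyf_if; [by polyf | | by polyf].
  apply: polyf_match; [by polyf | by polyf | ].
  apply: polyf_match; [by polyf | by polyf | ].
  apply: polyf_cons; last by polyf.
  apply: (@polyf_comp _ (tree * tree) tree _ _ _ (fun p => (p.1.2.1, p.2.1))
     (fun p => Node p.1 p.2)); last by polyf.
  by apply: polyf_recode.
- by polyf.
- exact: pbound_cst.
- move=> _ s' [] /=; last by rewrite csize_cons /csize /=; lia.
  by case: s' => [|t [|u s']] //; rewrite !csize_cons /csize /=; lia.
Qed.

(** * The encodings of the problem instances *)

Definition enc_tok (t : tok) : seq bool :=
  t.1 ++ (if t.1 == op_var then enc_seq (fun b => [:: b]) t.2 else [::]).

Lemma enc_formula_toks (f : formula) :
  enc_formula f = flatten (map enc_tok (toks f)).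
Proof.
by elim: f => //= [n|a ->|a -> b ->|a -> b ->|a -> b ->|a -> b ->];
  rewrite ?cats0 ?map_cat ?flatten_cat.
Qed.

Lemma polyf_enc_seq {A X : Type} {cA : coded A} {cX : coded X}
    (enc : X -> seq bool) (s : A -> seq X) :
  polyf enc -> polyf s -> polyf (fun a => enc_seq enc (s a)).
Proof.
move=> He Hs; rewrite /enc_seq; apply: polyf_cat; last by polyf.
apply: polyf_flatten; apply: polyf_map => //; apply: polyf_cons; first by polyf.
by apply: (polyf_comp He); polyf.
Qed.

Lemma polyf_enc_formula {A : Type} {cA : coded A} (f : A -> formula) :
  polyf f -> polyf (fun a => enc_formula (f a)).
Proof.
move=> Hf; apply: (@polyf_ext _ _ _ _ (fun a => flatten (map enc_tok (toks (f a))))).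
  by move=> a; rewrite enc_formula_toks.
apply: polyf_flatten; apply: polyf_map; last exact: polyf_toks.
rewrite /enc_tok; apply: polyf_cat; first by polyf.
by apply: polyf_if; [polyf | apply: polyf_enc_seq; polyf | polyf].
Qed.

Lemma polyf_enc_default {A : Type} {cA : coded A} (f : A -> default) :
  polyf f -> polyf (fun a => enc_default (f a)).
Proof.
move=> Hf; rewrite /enc_default; apply: polyf_cat.
  exact/polyf_enc_formula/polyf_prereq.
apply: polyf_cat; last exact/polyf_enc_formula/polyf_concl.
by apply: polyf_enc_seq; [exact/polyf_enc_formula/polyf_id | exact/polyf_justs].
Qed.

Lemma polyf_enc_instance {A : Type} {cA : coded A} (f : A -> instance) :
  polyf f -> polyf (fun a => enc_instance (f a)).
Proof.
move=> Hf; rewrite /enc_instance; apply: polyf_cat.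
  apply: polyf_enc_seq; [exact/polyf_enc_default/polyf_id | exact/polyf_defaults].
apply: polyf_cat.
  apply: polyf_enc_seq; [exact/polyf_enc_formula/polyf_id | exact/polyf_facts].
apply: polyf_cat; last exact/polyf_enc_formula/polyf_query.
apply: polyf_enc_seq; last exact/polyf_priority.
by apply: polyf_cat; apply: polyf_enc_default; polyf.
Qed.

Lemma size_enc_seq {X : Type} (enc : X -> seq bool) (s : seq X) :
  size (enc_seq enc s) = (sumn [seq (size (enc x)).+1 | x <- s]).+1.
Proof.
rewrite /enc_seq size_cat addn1; congr _.+1.
by elim: s => //= x s IH; rewrite size_cat IH.
Qed.

Lemma csize_sumn {X : Type} {cX : coded X} (s : seq X) :
  csize s = (sumn [seq (csize x).+1 | x <- s]).+1.
Proof. by elim: s => //= x s IH; rewrite csize_cons IH addnS. Qed.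

(* The summand [4] pays for the nodes of the surrounding structure. *)
Lemma csize_formula (f : formula) : csize f + 4 <= 10 * size (enc_formula f).
Proof.
have cE : csize f = csize (toks f) by []; rewrite {}cE.
have csize_bits (s : seq bool) : csize s <= (4 * size s).+1.
  by elim: s => // b s IH; rewrite csize_cons /=; have := csize_bool b; lia.
have size_nat n : size (enc_nat n) = (2 * size (nat_bits n)).+1.
  rewrite /enc_nat size_enc_seq; congr _.+1.
  by elim: (nat_bits n) => //= b s ->; lia.
have cons_le op (l : seq tok) : csize op <= 13 -> 
    csize ((op, [::] : seq bool) :: l) <= csize l + 16.
  by rewrite csize_cons csize_pair (_ : csize [::] = 1) //; lia.
elim: f => [n|||a IHa|a IHa b IHb|a IHa b IHb|a IHa b IHb|a IHa b IHb] //=.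
- rewrite size_nat csize_cons csize_pair (_ : csize op_var = 7) //.
  by rewrite (_ : csize [::] = 1) //; have := csize_bits (nat_bits n); lia.
- by have := cons_le op_neg (toks a) isT; lia.
all: rewrite size_cat.
all: have : (csize (toks a ++ toks b)).+1 = csize (toks a) + csize (toks b)
  by exact: csize_cat.
- by have := cons_le op_and (toks a ++ toks b) isT; lia.
- by have := cons_le op_or (toks a ++ toks b) isT; lia.
- by have := cons_le op_imp (toks a ++ toks b) isT; lia.
- by have := cons_le op_iff (toks a ++ toks b) isT; lia.
Qed.

Lemma csize_enc_seq {X : Type} {cX : coded X} (enc : X -> seq bool) (s : seq X) :
  (forall x, csize x <= 10 * size (enc x)) ->
  csize s + 9 <= 10 * size (enc_seq enc s).
Proof.
move=> H; rewrite size_enc_seq csize_sumn; elim: s => //= x s IH.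
by have := H x; lia.
Qed.

Lemma csize_default (d : default) : csize d + 4 <= 10 * size (enc_default d).
Proof.
have -> : csize d = (csize (prereq d) + (csize (justs d) + csize (concl d)).+1).+1
  by [].
have S3 (a b c : seq bool) : size (a ++ b ++ c) = size a + size b + size c.
  by rewrite !size_cat addnA.
rewrite /enc_default S3.
have H1 := csize_formula (prereq d); have H2 := csize_formula (concl d).
have : csize (justs d) + 9 <= 10 * size (enc_seq enc_formula (justs d)).
  by apply: csize_enc_seq => f; have := csize_formula f; lia.
by lia.
Qed.

Lemma csize_instance (x : instance) : csize x <= 10 * size (enc_instance x).
Proof.
have -> : csize x = (csize (defaults x) + (csize (facts x) +
  (csize (priority x) + csize (query x)).+1).+1).+1 by [].
have S4 (a b c e : seq bool) :
    size (a ++ b ++ c ++ e) = size a + size b + size c + size e.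
  by rewrite !size_cat !addnA.
rewrite /enc_instance S4.
have H1 := csize_formula (query x).
have : csize (defaults x) + 9 <= 10 * size (enc_seq enc_default (defaults x)).
  by apply: csize_enc_seq => d; have := csize_default d; lia.
have : csize (facts x) + 9 <= 10 * size (enc_seq enc_formula (facts x)).
  by apply: csize_enc_seq => f; have := csize_formula f; lia.
have : csize (priority x) + 9 <= 10 * size (enc_seq (fun p => enc_default p.1 ++
    enc_default p.2) (priority x)).
  apply: csize_enc_seq => -[d e]; rewrite size_cat csize_pair /=.
  by have := csize_default d; have := csize_default e; lia.
by lia.
Qed.

(** * Certificates for extensions *)

Definition models (v : nat -> bool) (S : seq formula) : bool := all (eval v) S.

Definition th (W : seq formula) (G : seq default) : seq formula :=
  W ++ map concl G.

Definition sat (V : seq (seq (seq bool))) (S : seq formula) (f : formula) :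
    bool :=
  has (fun l => models (vmem l) S && eval (vmem l) f) V.

(** [acc.1] says that [v] satisfies the facts and all conclusions read so far, [acc.2] that each
    prerequisite held at [v] if everything before it did. For all [v] together, this is derivability
    of every prerequisite from what precedes it. *)
Definition grounded_step (v : nat -> bool) (acc : bool * bool) (d : default) :
    bool * bool :=
  (acc.1 && eval v (concl d), acc.2 && (acc.1 ==> eval v (prereq d))).

Definition grounded (v : nat -> bool) (W : seq formula) (G : seq default) :
    bool :=
  (foldl (grounded_step v) (models v W, true) G).2.

(* A certificate that [G] lists the defaults applied in an extension, in an
   order in which they can be applied: [V] contains a model of the extension
   for each of the relevant formulas that have one, and [v] is a challenge. *)
Definition check (D : seq default) (W : seq formula) (G : seq default)
    (V : seq (seq (seq bool))) (v : nat -> bool) : bool :=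
  [&& all (fun d => d \in D) G, grounded v W G,
      all (fun d => all (fun b => sat V (th W G) b) (justs d)) G,
      all (fun d => [|| d \in G, sat V (th W G) (Neg (prereq d)) |
                     has (fun b => ~~ sat V (th W G) b) (justs d)]) D
    & all (fun d => all (fun b => sat V (th W G) b ||
             (models v (th W G) ==> ~~ eval v b)) (justs d)) D].

Lemma grounded_rcons (v : nat -> bool) (W : seq formula) (G : seq default) d :
  grounded v W (rcons G d) =
    grounded v W G && (models v (th W G) ==> eval v (prereq d)).
Proof.
rewrite /grounded foldl_rcons /=; congr (_ && (_ ==> _)).
elim/last_ind: G => [|G e IH]; first by rewrite /th cats0.
by rewrite foldl_rcons /= IH /th map_rcons -cats1 catA /models !all_cat /= andbT.
Qed.

Definition theory (S : seq formula) : set formula := Cn [set` S].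

Lemma theoryP (S : seq formula) (f : formula) :
  theory S f <-> forall v, models v S -> eval v f.
Proof.
split=> H v; first by move/allP => HS; apply: H => g /= /HS.
by move=> HS; apply: H; apply/allP => g /HS.
Qed.

Lemma CnK (S : set formula) : Cn (Cn S) = Cn S.
Proof.
apply/seteqP; split=> f H v vS; last exact: vS.
by apply: H => g; apply.
Qed.

Lemma neg_justs_disjoint (d : default) (E : set formula) :
  neg_justs d `&` E = set0 <-> forall b, b \in justs d -> ~ E (Neg b).
Proof.
split=> [H b db Eb|H].
  suff : (@set0 formula) (Neg b) by [].
  by rewrite -H; split=> //; exists b.
by apply/seteqP; split=> // f [[b db <-]]; apply: H.
Qed.

Lemma theory_neg (S : seq formula) (b : formula) :
  ~ theory S (Neg b) <-> exists2 v, models v S & eval v b.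
Proof.
split=> [H|[v vS vb] /theoryP/(_ v vS)]; last by rewrite /= vb.
apply: contra_notP H => H; apply/theoryP => v vS /=.
by apply/negP => vb; apply: H; exists v.
Qed.

Lemma sat_theory (V : seq (seq (seq bool))) (S : seq formula) (b : formula) :
  sat V S b -> exists2 v, models v S & eval v b.
Proof. by case/hasP => l _ /andP[? ?]; exists (vmem l). Qed.

(** * Lists that pass all challenges are exactly those that generate extensions *)

Section Soundness.
Variables (D : seq default) (W : seq formula) (G : seq default).
Variable V : seq (seq (seq bool)).
Hypothesis ok : forall v, check D W G V v.

Let E := theory (th W G).

Lemma check_justs (d : default) : d \in G -> neg_justs d `&` E = set0.
Proof.
move=> dG; apply/neg_justs_disjoint => b db; apply/theory_neg.
(* This clause does not mention the valuation, so any one will do. *)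
have /and5P[_ _ /allP/(_ _ dG)/allP/(_ _ db) H _ _] := ok xpredT.
exact: sat_theory H.
Qed.

(** Induction along the order of application: the prerequisite of the last default follows from the
    generators before it, which already lie in [X]. *)
Lemma check_sub (X : set formula) :
  Gamma_closed [set` D] E X -> [set` W] `<=` X -> forall f, f \in th W G -> X f.
Proof.
move=> [CX DX] WX.
have grd v : grounded v W G by have /and5P[] := ok v.
have GD d : d \in G -> d \in D by have /and5P[/allP H _ _ _ _] := ok xpredT => /H.
(* Groundedness, membership in [D] and consistency of justifications pass to prefixes, unlike
   [check] as a whole; [E] stays the theory of the full list. *)
have := check_justs; elim/last_ind: G grd GD => [|G' d IH] grd GD GJ f.
  by rewrite /th cats0 => /WX.
have th' g : g \in th W G' -> X g.
  apply: IH => [v|e eG|e eG].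
  - by have := grd v; rewrite grounded_rcons => /andP[].
  - by apply: GD; rewrite mem_rcons inE eG orbT.
  - by apply: GJ; rewrite mem_rcons inE eG orbT.
rewrite /th map_rcons -cats1 catA mem_cat => /orP[/th' //|].
rewrite inE => /eqP ->; apply: (DX d).
- by apply: GD; rewrite mem_rcons inE eqxx.
- rewrite -CX => v vX; have := grd v; rewrite grounded_rcons => /andP[_ /implyP].
  by apply; apply/allP => g /th'/vX.
- by apply: GJ; rewrite mem_rcons inE eqxx.
Qed.

(** For a default outside [G], a listed model refutes the prerequisite or some justification has no
    listed model. The last clause of [check], at all valuations, turns the latter into the absence
    of any model, so the negated justification lies in [E]. *)
Lemma check_applied (d : default) :
  d \in D -> E (prereq d) -> neg_justs d `&` E = set0 -> d \in G.
Proof.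
move=> dD Ed /neg_justs_disjoint dJ.
have /and5P[_ _ _ /allP/(_ _ dD)] := ok xpredT.
case/or3P => // [/sat_theory[v vS] /=|/hasP[b db nb] _].
  by move/theoryP: Ed => /(_ v vS) ->.
case: (dJ b db); apply/theoryP => v vS /=.
have /and5P[_ _ _ _ /allP/(_ _ dD)/allP/(_ _ db)] := ok v.
by rewrite (negPf nb) vS.
Qed.

(** [E] is closed because every applicable default is listed, so it contains the least closed set;
    conversely each closed set containing the facts contains the generators of [E]. *)
Lemma check_extension : extension [set` D] [set` W] E.
Proof.
have WE : [set` W] `<=` E.
  by move=> f /= fW v; apply; rewrite /= mem_cat fW.
apply/seteqP; split.
  move=> f; apply; split=> //; split; first exact: CnK.
  move=> d dD dE dJ; have dG := check_applied dD dE dJ.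
  by apply/theoryP => v /allP; apply; rewrite mem_cat map_f ?orbT.
move=> f fE X [cX WX]; have H := check_sub cX WX; case: cX => CX _.
by rewrite -CX => v vX; apply: fE => g /H/vX.
Qed.

Lemma check_appl (d : default) : d \in D -> appl d E <-> d \in G.
Proof.
move=> dD; rewrite /appl CnK; split=> [[dE dJ]|dG].
  by apply: check_applied => //; rewrite -[E]CnK.
split; last exact: check_justs.
rewrite /E; case/splitPr: dG (ok) => G1 G2 okG v vE.
have : grounded v W (rcons G1 d).
  have /and5P[_ + _ _ _] := okG v; rewrite -cat_rcons.
  elim/last_ind: G2 {vE okG} => [|G2 e IH]; first by rewrite cats0.
  by rewrite -rcons_cat grounded_rcons => /andP[/IH].
rewrite grounded_rcons => /andP[_ /implyP]; apply; apply/allP => g gG1.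
apply: vE; apply/theoryP => v' /allP; apply.
by move: gG1; rewrite /th map_cat !mem_cat => /orP[->//|->]; rewrite !orbT.
Qed.

End Soundness.

Lemma extension_Cn (D : set default) (W E : set formula) :
  extension D W E -> Cn E = E.
Proof. by move=> <-; have [] := GammaP D W E. Qed.

(** These are the formulas for which [check] looks up a model in [V]. *)
Definition witnessed (D : seq default) : seq formula :=
  flatten [seq Neg (prereq d) :: justs d | d <- D].

Lemma mem_witnessed (D : seq default) (d : default) (f : formula) :
  d \in D -> (f == Neg (prereq d)) || (f \in justs d) -> f \in witnessed D.
Proof.
by move=> dD H; apply/flattenP; exists (Neg (prereq d) :: justs d);
  [apply/mapP; exists d | rewrite inE].
Qed.

(** Take a longest duplicate-free grounded list of defaults applied in [E]. By maximality no applied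
    default with a prerequisite derivable from the list is missing, so the theory of the list is
    closed in the sense of [Gamma_closed] for [E] and, by minimality of [Gamma E], contains [E]. *)
Lemma extension_generated (D : seq default) (W : seq formula) (E : set formula) :
  extension [set` D] [set` W] E ->
  exists G, [/\ uniq G, {subset G <= D}, E = theory (th W G),
    forall d, d \in D -> appl d E <-> d \in G &
    forall v, grounded v W G].
Proof.
move=> extE; have CE := extension_Cn extE.
have [cE WE] : Gamma_closed [set` D] E E /\ [set` W] `<=` E.
  split; first by rewrite -{2}extE; exact: GammaP.
  by rewrite -extE => f fW X [_]; apply.
pose P G := [/\ uniq G, forall d, d \in G -> d \in D /\ appl d E &
  forall v, grounded v W G].
pose p n := `[< exists2 G, P G & size G = n >].
have p0 : exists n, p n by exists 0; apply/asboolP; exists [::].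
have pD n : p n -> n <= size D.
  by move/asboolP => [G [uG GD _] <-]; apply: uniq_leq_size => // d /GD[].
case: (ex_maxnP p0 pD) => n /asboolP[G [uG GD gG] sG] maxG.
have GE g : g \in th W G -> E g.
  rewrite mem_cat => /orP[/WE //|/mapP[d dG ->]].
  have [dD [dE dJ]] := GD d dG.
  by apply: (cE.2 d); rewrite // -CE.
have thE : theory (th W G) `<=` E.
  by move=> f H; rewrite -CE => v vE; apply: H => g /GE/vE.
have applG d : d \in D -> appl d E -> theory (th W G) (prereq d) -> d \in G.
  move=> dD dE dth; apply: contraT => dG.
  have : p n.+1; last by move/maxG; rewrite ltnn.
  apply/asboolP; exists (rcons G d); last by rewrite size_rcons sG.
  split; first by rewrite rcons_uniq dG.
    by move=> e; rewrite mem_rcons inE => /orP[/eqP ->|/GD].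
  move=> v; rewrite grounded_rcons gG; apply/implyP => vS.
  by move/theoryP: dth; apply.
have EthE : E = theory (th W G).
  apply/seteqP; split=> //; rewrite -{1}extE => f; apply; split; last first.
    by move=> g /= gW v; apply; rewrite /= mem_cat gW.
  split; first exact: CnK.
  move=> d dD dth dJ.
  have dG : d \in G.
    apply: applG => //; split; last by rewrite CE.
    by have : Cn E (prereq d) by rewrite CE; apply: thE.
  by apply/theoryP => v /allP; apply; rewrite mem_cat map_f ?orbT.
exists G; split=> // [d /GD[]|d dD] //; split=> [dE|/GD[]] //.
by apply: applG => //; rewrite -EthE -CE; case: dE.
Qed.

Lemma check_complete (D : seq default) (W : seq formula) (G : seq default)
    (V : seq (seq (seq bool))) :
  {subset G <= D} -> (forall v, grounded v W G) ->
  (forall d, d \in D -> appl d (theory (th W G)) <-> d \in G) ->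
  (forall f v, f \in witnessed D -> models v (th W G) -> eval v f ->
     sat V (th W G) f) ->
  forall v, check D W G V v.
Proof.
move=> GD gG applG HV v; apply/and5P; split=> //.
- exact/allP.
- apply/allP => d dG; apply/allP => b db; have dD := GD d dG.
  have [_] := (applG d dD).2 dG; rewrite CnK.
  move/neg_justs_disjoint/(_ b db)/theory_neg => [v' vS vb].
  by apply: HV vS vb; apply: mem_witnessed dD _; rewrite db orbT.
- apply/allP => d dD; case: (boolP (d \in G)) => //= dG.
  case: (boolP (sat _ _ _)) => //= nsat.
  apply: contraNT dG => /hasPn H; apply/(applG d dD); split; last rewrite CnK.
    suff : Cn (theory (th W G)) (prereq d) by [].
    rewrite CnK; apply/theoryP => v' vS; apply: contraNT nsat => nv.
    by apply: HV vS _; first by apply: mem_witnessed dD _; rewrite eqxx.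
  apply/neg_justs_disjoint => b db; apply/theory_neg.
  by apply: (@sat_theory V); have := H b db; rewrite negbK.
- apply/allP => d dD; apply/allP => b db.
  case: (boolP (sat _ _ _)) => //= nsat; apply/implyP => vS.
  apply: contra nsat => vb; apply: HV vS vb.
  by apply: mem_witnessed dD _; rewrite db orbT.
Qed.

(** * The verifier *)

Notation valuation := (seq (seq bool)).

Definition po_ok (D : seq default) (R : seq (default * default)) : bool :=
  [&& all (fun p => (p.1 \in D) && (p.2 \in D)) R,
      all (fun p => all (fun q => (p.2 == q.1) ==> ((p.1, q.2) \in R)) R) R
    & all (fun p => all (fun q => ~~ ((p.1 == q.2) && (p.2 == q.1))) R) R].

Lemma po_okP (D : seq default) (R : seq (default * default)) :
  reflect (strict_partial_order_on [set` D] (fun d e => (d, e) \in R))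
    (po_ok D R).
Proof.
apply: (iffP and3P) => [[/allP H1 /allP H2 /allP H3]|[H1 H2 H3]]; split.
- by move=> d e /H1/andP.
- move=> d e f /H2/allP H /H /=; by rewrite eqxx.
- by move=> d e /H3/allP H /H /=; rewrite !eqxx.
- by apply/allP => -[d e] /H1[/= -> ->].
- apply/allP => -[d e] de; apply/allP => -[e' f] ef /=; apply/implyP => /eqP E.
  by apply: H2 de _; rewrite E.
- apply/allP => -[d e] de; apply/allP => -[e' d'] ed /=.
  by apply/negP => /andP[/eqP E1 /eqP E2]; apply: (H3 _ _ de); rewrite E1 E2.
Qed.

Definition total_on (D : seq default) (T : seq (default * default)) : bool :=
  all (fun d => all (fun e => [|| d == e, (d, e) \in T | (e, d) \in T]) D) D.

(** All requirements on a claim except the preference condition, which concerns the other extensions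
    and is contested through [unbeaten]. *)
Definition refutes (y : instance) (G : seq default) (V : seq valuation)
    (T : seq (default * default)) (v : nat -> bool) : bool :=
  [&& check (defaults y) (facts y) G V v,
      sat V (th (facts y) G) (Neg (query y)),
      po_ok (defaults y) T, total_on (defaults y) T
    & all (fun p => p \in T) (priority y)].

(** The negation of the preference condition of [preferred] at a single [E'], with membership in [G]
    and [G'] in place of [appl]. *)
Definition unbeaten (G G' : seq default) (T : seq (default * default)) : bool :=
  has (fun d => (d \notin G) &&
    all (fun e => ((e \in G) && (e \notin G')) ==> ((e, d) \notin T)) G) G'.

Notation claim :=
  (seq default * (seq valuation * seq (default * default)))%type.
Notation reply := (instance * (valuation * (seq default * seq valuation)))%type.

(* The universal player claims that [G] generates an extension [E], certified by
   [V], which satisfies the preference condition for the total order [T] and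
   lacks the query. The reply contains the decoded instance, a challenge to
   that certificate, and a certificate for an extension violating the preference
   condition; the last valuation is the challenge to the latter certificate. *)
Definition verify (q : seq bool * (claim * (reply * valuation))) : bool :=
  let y := q.2.2.1.1 in
  [&& enc_instance y == q.1, po_ok (defaults y) (priority y) &
      refutes y q.2.1.1 q.2.1.2.1 q.2.1.2.2 (vmem q.2.2.1.2.1) ==>
      (check (defaults y) (facts y) q.2.2.1.2.2.1 q.2.2.1.2.2.2
         (vmem q.2.2.2) &&
       unbeaten q.2.1.1 q.2.2.1.2.2.1 q.2.1.2.2)].

Ltac polyf_step ::=
  first
    [ exact: polyf_id | assumption | exact: polyf_cst
    | apply: polyf_fst | apply: polyf_snd | apply: polyf_pair
    | apply: polyf_andb | apply: polyf_orb | apply: polyf_negb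
    | apply: polyf_implb | apply: polyf_if | apply: polyf_mem | apply: polyf_eq
    | apply: polyf_cons | apply: polyf_cat | apply: polyf_flatten
    | apply: polyf_defaults | apply: polyf_facts | apply: polyf_priority
    | apply: polyf_query | apply: polyf_prereq | apply: polyf_justs
    | apply: polyf_concl | apply: polyf_eval
    | apply: polyf_all; cbn beta | apply: polyf_has; cbn beta
    | apply: polyf_map; cbn beta | apply: polyf_rev ].

Lemma polyf_po_ok {A : Type} {cA : coded A} (D : A -> seq default)
    (R : A -> seq (default * default)) :
  polyf D -> polyf R -> polyf (fun a => po_ok (D a) (R a)).
Proof. by apply: polyf_app2; rewrite /po_ok; polyf. Qed.

Lemma polyf_total_on {A : Type} {cA : coded A} (D : A -> seq default)
    (T : A -> seq (default * default)) :
  polyf D -> polyf T -> polyf (fun a => total_on (D a) (T a)).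
Proof. by apply: polyf_app2; rewrite /total_on; polyf. Qed.

Lemma polyf_unbeaten {A : Type} {cA : coded A} (G G' : A -> seq default)
    (T : A -> seq (default * default)) :
  polyf G -> polyf G' -> polyf T -> polyf (fun a => unbeaten (G a) (G' a) (T a)).
Proof. by apply: polyf_app3; rewrite /unbeaten; polyf. Qed.

Lemma polyf_models {A : Type} {cA : coded A} (v : A -> valuation)
    (S : A -> seq formula) :
  polyf v -> polyf S -> polyf (fun a => models (vmem (v a)) (S a)).
Proof.
apply: (@polyf_app2 _ _ _ _ _ _ _ _ (fun v S => models (vmem v) S)).
apply: (@polyf_all _ _ _ _ (fun (p : valuation * seq formula) f => 
  eval (vmem p.1) f)); by polyf.
Qed.

Lemma polyf_th {A : Type} {cA : coded A} (W : A -> seq formula)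
    (G : A -> seq default) :
  polyf W -> polyf G -> polyf (fun a => th (W a) (G a)).
Proof.
apply: polyf_app2; rewrite /th; apply: polyf_cat; first by polyf.
by apply: (@polyf_map _ _ _ _ _ _ (fun _ d => concl d)); polyf.
Qed.

Lemma polyf_sat {A : Type} {cA : coded A} (V : A -> seq valuation)
    (S : A -> seq formula) (f : A -> formula) :
  polyf V -> polyf S -> polyf f -> polyf (fun a => sat (V a) (S a) (f a)).
Proof.
apply: polyf_app3; rewrite /sat; apply: polyf_has; cbn beta; last by polyf.
by apply: polyf_andb; [apply: polyf_models|]; polyf.
Qed.

Lemma polyf_from_toks {A : Type} {cA : coded A} (f : A -> formula) :
  polyf (fun a => toks (f a)) -> polyf f.
Proof. by move=> [c [g H]]; exists c, g. Qed.

Lemma polyf_neg {A : Type} {cA : coded A} (f : A -> formula) :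
  polyf f -> polyf (fun a => Neg (f a)).
Proof.
by move=> Hf; apply: polyf_from_toks; apply: polyf_cons;
  [polyf | apply: polyf_toks].
Qed.

Lemma polyf_grounded {A : Type} {cA : coded A} (v : A -> valuation)
    (W : A -> seq formula) (G : A -> seq default) :
  polyf v -> polyf W -> polyf G ->
  polyf (fun a => grounded (vmem (v a)) (W a) (G a)).
Proof.
apply: (@polyf_app3 _ _ _ _ _ _ _ _ _ _ (fun v W G => grounded (vmem v) W G)).
rewrite /grounded; apply: polyf_snd.
apply: (@polyf_foldl _ _ _ _ _ _ (fun p : valuation * (seq formula * seq default) =>
  grounded_step (vmem p.1)) _ _ (fun=> 7)).
- by rewrite /grounded_step; polyf.
- by polyf.
- by apply: polyf_pair; [apply: polyf_models|]; polyf.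
- exact: pbound_cst.
- move=> a b d; rewrite csize_pair.
  have := csize_bool (grounded_step (vmem a.1) b d).1.
  have := csize_bool (grounded_step (vmem a.1) b d).2.
  by rewrite /grounded_step /=; lia.
Qed.

Lemma polyf_check {A : Type} {cA : coded A} (D : A -> seq default)
    (W : A -> seq formula) (G : A -> seq default) (V : A -> seq valuation)
    (v : A -> valuation) :
  polyf D -> polyf W -> polyf G -> polyf V -> polyf v ->
  polyf (fun a => check (D a) (W a) (G a) (V a) (vmem (v a))).
Proof.
move=> HD HW HG HV Hv.
apply: (@polyf_comp _ (seq default * (seq formula * (seq default *
  (seq valuation * valuation)))) _ _ _ _
  (fun a => (D a, (W a, (G a, (V a, v a)))))
  (fun q => check q.1 q.2.1 q.2.2.1 q.2.2.2.1 (vmem q.2.2.2.2)));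
  last by polyf.
rewrite /check.
apply: polyf_andb; last apply: polyf_andb; last apply: polyf_andb;
  last apply: polyf_andb.
- by polyf.
- by apply: polyf_grounded; polyf.
- apply: polyf_all; cbn beta; last by polyf.
  apply: polyf_all; cbn beta; last by polyf.
  by apply: polyf_sat; [polyf | apply: polyf_th; polyf | polyf].
- apply: polyf_all; cbn beta; last by polyf.
  apply: polyf_orb; first by polyf.
  apply: polyf_orb.
    by apply: polyf_sat; [polyf | apply: polyf_th; polyf | apply: polyf_neg; polyf].
  apply: polyf_has; cbn beta; last by polyf.
  by apply: polyf_negb; apply: polyf_sat; [polyf | apply: polyf_th; polyf | polyf].
- apply: polyf_all; cbn beta; last by polyf.
  apply: polyf_all; cbn beta; last by polyf.
  apply: polyf_orb.
    by apply: polyf_sat; [polyf | apply: polyf_th; polyf | polyf].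
  apply: polyf_implb; last by polyf.
  by apply: polyf_models; [polyf | apply: polyf_th; polyf].
Qed.

Lemma polyf_verify : polyf verify.
Proof.
rewrite /verify; apply: polyf_andb.
  by apply: polyf_eq; [apply: polyf_enc_instance; polyf | polyf].
apply: polyf_andb; first by apply: polyf_po_ok; polyf.
apply: polyf_implb.
  rewrite /refutes; apply: polyf_andb; first by apply: polyf_check; polyf.
  apply: polyf_andb.
    by apply: polyf_sat; [polyf | apply: polyf_th; polyf | apply: polyf_neg; polyf].
  apply: polyf_andb; first by apply: polyf_po_ok; polyf.
  by apply: polyf_andb; [apply: polyf_total_on; polyf | polyf].
apply: polyf_andb; first by apply: polyf_check; polyf.
by apply: polyf_unbeaten; polyf.
Qed.

Definition verify_strings (us : seq (seq bool)) : bool :=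
  verify (nth [::] us 0, (of_bits (nth [::] us 1),
    (of_bits (nth [::] us 2), of_bits (nth [::] us 3)))).

Lemma polyf_nth {A : Type} {cA : coded A} (s : A -> seq (seq bool)) (n : nat) :
  polyf s -> polyf (fun a => nth [::] (s a) n).
Proof.
apply: (@polyf_comp _ _ _ _ _ _ _ (fun s => nth [::] s n)).
elim: n => [|n IH].
  apply: (@polyf_ext _ _ _ _ (fun s => match s with [::] => [::] | x :: _ => x end)).
    by case.
  by apply: polyf_match; polyf.
apply: (@polyf_ext _ _ _ _
  (fun s => match s with [::] => [::] | _ :: l => nth [::] l n end)).
  by case.
by apply: polyf_match; [polyf | polyf | apply: (polyf_comp IH); polyf].
Qed.

Lemma polyf_verify_strings : polyf verify_strings.
Proof.
apply: (polyf_comp polyf_verify); apply: polyf_pair; first exact/polyf_nth/polyf_id.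
by apply: polyf_pair; [|apply: polyf_pair]; apply: polyf_of_bits;
  exact/polyf_nth/polyf_id.
Qed.

(** * From polynomial-time functions to [in_P] *)

(* The separator [None] and the bits are coded as lists of length at most 1. *)
Definition letter (o : option bool) : seq bool :=
  if o is Some b then [:: b] else [::].

Definition split_step (c : seq bool) (us : seq (seq bool)) : seq (seq bool) :=
  match c with
  | [::] => [::] :: us
  | b :: _ => match us with [::] => [::] | u :: us' => (b :: u) :: us' end
  end.

Definition split_letters (w : seq (seq bool)) : seq (seq bool) :=
  foldr split_step [::] w.

Lemma split_tuple_string (us : seq (seq bool)) :
  split_letters [seq letter c | c <- tuple_string us] = us.
Proof.
elim: us => //= u us IH; rewrite /tuple_string /= map_cat /split_letters.
rewrite foldr_cat -/(split_letters _) IH.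
by elim: u => //= b u; rewrite /split_letters => ->.
Qed.

Lemma polyf_split_letters : polyf split_letters.
Proof.
rewrite /split_letters.
apply: (@polyf_foldr _ _ _ _ _ _ (fun _ => split_step) _ _
  (fun p => csize p + 2)).
- rewrite /split_step; apply: polyf_match; [by polyf | by polyf | ].
  apply: polyf_match; by polyf.
- by polyf.
- by polyf.
- by pbound.
- move=> a us [|b c] /=; first by rewrite csize_cons (_ : csize [::] = 1) //; lia.
  case: us => [|u us]; first by rewrite leq_addr.
  by rewrite csize_pair !csize_cons; lia.
Qed.

Definition unload : cmd :=
  While R0 some_top
    (If R0 (fun o => o == Some None) (Seq (Pop R0) (Push R1 None))
       (mv_bit R0 R1)).

Lemma unloadP (w a c d : seq sgn) :
  runs unload (Store w a c d) (Store [::] (rev w ++ a) c d) (6 * size w + 1).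
Proof.
elim: w a => [|x w IH] a; first exact: runs_while0.
rewrite rev_cons cat_rcons.
apply: (@runs_le _ _ _ (5 + (6 * size w + 1)).+1); first by rewrite /=; lia.
apply: runs_while (IH _) => //; apply: runs_if; case: x => [b|] /=.
  exact: (@mv_bitP R0 R1 b (Store (Some b :: w) a c d)).
by straight.
Qed.

Definition cell_bits (x : sgn) : seq bool := true :: tbits (code (letter x)).

Definition recode : cmd :=
  While R1 some_top
    (Seq (If R1 (fun o => o == Some None) (push_bits (cell_bits None))
           (If R1 is1 (push_bits (cell_bits (Some true)))
              (push_bits (cell_bits (Some false)))))
       (Pop R1)).

Lemma recodeP (l : seq sgn) (t : seq (seq bool)) :
  runs recode (Store (raw (tbits (code t))) l [::] [::])
    (st0 (raw (tbits (code (catrev (map letter l) t))))) (17 * size l + 1).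
Proof.
elim: l t => [|x l IH] t; first exact: runs_while0.
apply: (@runs_le _ _ _ ((15 + 1) + (17 * size l + 1)).+1).
  by rewrite /=; lia.
apply: runs_while (IH (letter x :: t)) => //.
apply: (@runs_seq _ _ _ (Store (raw (tbits (code (letter x :: t)))) (x :: l)
  [::] [::])); last exact: runs_pop.
have -> : raw (tbits (code (letter x :: t))) =
    raw (cell_bits x) ++ raw (tbits (code t)).
  by rewrite /raw -map_cat.
apply: runs_if; case: x => [[]|].
- apply: (@runs_if R1 is1 _ _ _ _ 13).
  exact: (push_bitsP (cell_bits (Some true))).
- apply: (@runs_le _ _ _ 10) => //; apply: (@runs_if R1 is1 _ _ _ _ 9).
  exact: (push_bitsP (cell_bits (Some false))).
- by apply: (@runs_le _ _ _ 5) => //; exact: (push_bitsP (cell_bits None)).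
Qed.

(** The code of a list ends with a leaf and is pushed from its end, so the input is first reversed
    onto [R1]. *)
Definition load : cmd := Seq unload (Seq (Push R0 (Some false)) recode).

Lemma loadP (w : seq sgn) :
  runs load (st0 w) (st0 (raw (tbits (code (map letter w)))))
    (23 * size w + 4).
Proof.
apply: (@runs_le _ _ _ ((6 * size w + 1) + (2 + (17 * size w + 1)))); first lia.
apply: runs_seq; first exact: unloadP.
apply: runs_seq; first exact: runs_push.
have := recodeP (rev w) [::]; rewrite size_rev map_rev -[catrev _ _]/(rev _).
by rewrite revK /= cats0.
Qed.

Lemma csize_letters (w : seq sgn) : csize (map letter w) <= 6 * size w + 1.
Proof.
elim: w => // x w IH; rewrite [map _ _]/= csize_cons.
have : csize (letter x) <= 5 by case: x => [[]|].
by rewrite /=; lia.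
Qed.

Lemma poly_nat (a b c d k : nat) :
  exists p : {poly nat}, forall n, (p.[n])%R = (a * n + b) ^ k + c * n + d.
Proof.
exists ((a%:P * 'X + b%:P) ^+ k + c%:P * 'X + d%:P)%R => n.
rewrite !(hornerD, hornerC, hornerM, hornerX); congr (_ + _ + _).
elim: k => [|k IH]; first by rewrite GRing.expr0 hornerC.
by rewrite GRing.exprS hornerM IH expnS !(hornerD, hornerC, hornerM, hornerX).
Qed.

Lemma in_P_polyf (f : seq (seq bool) -> bool) :
  polyf f -> in_P [set w : seq sgn | f (map letter w)].
Proof.
move=> [c [g [[k Hk] H]]].
(* For inputs of length n, the code has size at most 6n + 1, which gives [(6n + 2) ^ k] for [c];
   loading takes 23n + 4 and the verdict one more step. *)
have [p Hp] := poly_nat 6 2 23 5 k; exists (tm (Seq load c)), p => w.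
have [t Ht E] : runs (Seq load c) (st0 w)
    (st0 (raw (tbits (code (f (map letter w))))))
    ((23 * size w + 4) + g (map letter w)).
  apply: runs_seq; first exact: loadP.
  by have := H (map letter w) [::]; rewrite /tstack !cats0.
exists t.+1, (f (map letter w)); split=> //.
- rewrite Hp.
  have : g (map letter w) <= (6 * size w + 2) ^ k.
    apply: leq_trans (Hk _) _; apply: leq_expl.
    rewrite addn2 ltnS -addn1; exact: csize_letters.
  by move: Ht ((_ + 2) ^ k) => Ht P; lia.
- rewrite (tm_outcome E) /=; congr Some.
  by case: (f _).
Qed.

(** * Unique decodability *)

Definition prefix_free {X : Type} (enc : X -> seq bool) : Prop :=
  forall a b r s, enc a ++ r = enc b ++ s -> a = b /\ r = s.

Lemma prefix_free_seq {X : Type} (enc : X -> seq bool) :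
  prefix_free enc -> prefix_free (enc_seq enc).
Proof.
move=> H a b r r'; rewrite /enc_seq -!catA /=.
elim: a b => [|x s IH] [|y t] //=; first by case.
by case; rewrite -!catA => /H[-> /IH[-> ->]].
Qed.

Lemma prefix_free_nat : prefix_free enc_nat.
Proof.
have pf1 : prefix_free (fun b : bool => [:: b]) by move=> b c r s [-> ->].
by move=> m n r s /(prefix_free_seq pf1)[/(can_inj nat_bitsK) -> ->].
Qed.

Lemma prefix_free_formula : prefix_free enc_formula.
Proof.
elim=> [m|||a IHa|a IHa b IHb|a IHa b IHb|a IHa b IHb|a IHa b IHb]
  [n|||c|c d|c d|c d|c d] r s //=.
- by case=> /prefix_free_nat[-> ->].
- by case.
- by case.
- by case=> /IHa[-> ->].
all: by case; rewrite -!catA => /IHa[-> /IHb[-> ->]].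
Qed.

Lemma prefix_free_cat {X Y : Type} (enc1 : X -> seq bool)
    (enc2 : Y -> seq bool) :
  prefix_free enc1 -> prefix_free enc2 ->
  prefix_free (fun p : X * Y => enc1 p.1 ++ enc2 p.2).
Proof.
by move=> H1 H2 [a b] [c d] r s; rewrite /= -!catA => /H1[-> /H2[-> ->]].
Qed.

Lemma prefix_free_default : prefix_free enc_default.
Proof.
move=> d e r s E.
have [|/(can_inj of_defaultK)] := prefix_free_cat prefix_free_formula
  (prefix_free_cat (prefix_free_seq prefix_free_formula) prefix_free_formula)
  (a := of_default d) (b := of_default e) (r := r) (s := s); last by [].
exact: E.
Qed.

(** This ties together the instances contained in different replies of the existential player. *)
Lemma enc_instance_inj : injective enc_instance.
Proof.
move=> x y E; apply: (can_inj of_instanceK).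
have pf := prefix_free_cat (prefix_free_seq prefix_free_default)
  (prefix_free_cat (prefix_free_seq prefix_free_formula)
    (prefix_free_cat (prefix_free_seq
       (prefix_free_cat prefix_free_default prefix_free_default))
     prefix_free_formula)).
have [] := pf (of_instance x) (of_instance y) [::] [::] _; last by [].
by rewrite !cats0; exact: E.
Qed.

(** * Short valuations *)

Fixpoint fvars (f : formula) : seq nat :=
  match f with
  | Var n => [:: n]
  | Top | Bot => [::]
  | Neg a => fvars a
  | And a b | Or a b | Imp a b | Iff a b => fvars a ++ fvars b
  end.

Definition restrict (v : nat -> bool) (s : seq nat) : valuation :=
  [seq nat_bits n | n <- s & v n].

Lemma vmem_restrict (v : nat -> bool) (s : seq nat) (n : nat) :
  n \in s -> vmem (restrict v s) n = v n.
Proof.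
move=> ns; rewrite /vmem mem_map; last exact: can_inj nat_bitsK.
by rewrite mem_filter ns andbT.
Qed.

Lemma eval_restrict (v : nat -> bool) (s : seq nat) (f : formula) :
  {subset fvars f <= s} -> eval (vmem (restrict v s)) f = eval v f.
Proof.
elim: f => //= [n|a IHa|a IHa b IHb|a IHa b IHb|a IHa b IHb|a IHa b IHb] H;
  rewrite ?IHa ?IHb //; try by move=> n Hn; apply: H; rewrite mem_cat Hn ?orbT.
by apply: vmem_restrict; apply: H; rewrite inE.
Qed.

Definition iforms (y : instance) : seq formula :=
  facts y ++ flatten [seq [:: prereq d, concl d & justs d] | d <- defaults y] ++
  [:: query y].

Definition ivars (y : instance) : seq nat := flatten (map fvars (iforms y)).

Definition shorten (y : instance) (v : nat -> bool) : valuation :=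
  restrict v (ivars y).

Lemma eval_shorten (y : instance) (v : nat -> bool) (f : formula) :
  f \in iforms y -> eval (vmem (shorten y v)) f = eval v f.
Proof.
by move=> fy; apply: eval_restrict => n nf; apply/flattenP; exists (fvars f);
  rewrite // map_f.
Qed.

Lemma mem_iforms (y : instance) (d : default) (f : formula) :
  d \in defaults y -> f \in [:: prereq d, concl d & justs d] -> f \in iforms y.
Proof.
move=> dy fd; rewrite !mem_cat; apply/or3P; apply: Or32; apply/flattenP.
by exists [:: prereq d, concl d & justs d] => //; apply/mapP; exists d.
Qed.

Lemma csize_flatten_map {X Y : Type} {cX : coded X} {cY : coded Y}
    (f : X -> seq Y) (s : seq X) :
  (forall x, csize (f x) <= csize x) -> csize (flatten (map f s)) <= csize s.
Proof.
move=> H; elim: s => //= x s IH; rewrite csize_cons.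
have : (csize (f x ++ flatten (map f s))).+1 = csize (f x) +
  csize (flatten (map f s)) by exact: csize_cat.
by have := H x; lia.
Qed.

Lemma csize_iforms (y : instance) : csize (iforms y) <= csize y.
Proof.
have -> : csize y = (csize (defaults y) + (csize (facts y) +
  (csize (priority y) + csize (query y)).+1).+1).+1 by [].
have H : csize (flatten [seq [:: prereq d, concl d & justs d] |
    d <- defaults y]) <= csize (defaults y).
  apply: csize_flatten_map => d; rewrite !csize_cons.
  have -> : csize d =
    (csize (prereq d) + (csize (justs d) + csize (concl d)).+1).+1 by [].
  by lia.
rewrite /iforms; move: (flatten _) H => F H.
have E1 : (csize (facts y ++ F ++ [:: query y])).+1 =
  csize (facts y) + csize (F ++ [:: query y]) by exact: csize_cat.
have E2 : (csize (F ++ [:: query y])).+1 = csize F + csize [:: query y].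
  exact: csize_cat.
have E3 : csize [:: query y] = (csize (query y) + 1).+1 by [].
by lia.
Qed.

Lemma csize_fvars (f : formula) : csize (map nat_bits (fvars f)) <= csize f.
Proof.
have -> : csize f = csize (toks f) by [].
have tok_le op (l : seq tok) : csize l <= csize ((op, [::] : seq bool) :: l).
  by rewrite csize_cons; lia.
elim: f => [n|||a IHa|a IHa b IHb|a IHa b IHb|a IHa b IHb|a IHa b IHb] //=.
- have -> : csize [:: nat_bits n] = (csize (nat_bits n) + 1).+1 by [].
  have -> : csize [:: (op_var, nat_bits n)] =
    ((csize op_var + csize (nat_bits n)).+1 + 1).+1 by [].
  by lia.
- by apply: leq_trans IHa _; apply: tok_le.
all: apply: (leq_trans _ (tok_le _ _)); rewrite map_cat.
all: have E1 : (csize (map nat_bits (fvars a) ++ map nat_bits (fvars b))).+1 =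
  csize (map nat_bits (fvars a)) + csize (map nat_bits (fvars b))
  by exact: csize_cat.
all: have E2 : (csize (toks a ++ toks b)).+1 = csize (toks a) + csize (toks b)
  by exact: csize_cat.
all: by lia.
Qed.

Lemma csize_shorten (y : instance) (v : nat -> bool) :
  csize (shorten y v) <= csize y.
Proof.
apply: leq_trans (csize_iforms y); rewrite /shorten /restrict.
apply: (@leq_trans (csize (map nat_bits (ivars y)))).
  elim: (ivars y) => //= n s IH; case: (v n); rewrite /= !csize_cons; lia.
rewrite /ivars map_flatten -map_comp; apply: csize_flatten_map => f /=.
exact: csize_fvars.
Qed.

Lemma csize_bound {X : eqType} {cX : coded X} (s : seq X) (b : nat) :
  (forall x, x \in s -> csize x <= b) -> csize s <= size s * b.+1 + 1.
Proof.
elim: s => // x s IH H; rewrite csize_cons [size _]/= mulSn.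
have Hx : csize x <= b by apply: H; rewrite inE eqxx.
have : csize s <= size s * b.+1 + 1.
  by apply: IH => z zs; apply: H; rewrite inE zs orbT.
by move: (_ * _) => ?; lia.
Qed.

Lemma csize_mem {X : eqType} {cX : coded X} (x : X) (s : seq X) :
  x \in s -> csize x <= csize s.
Proof.
elim: s => // z s IH; rewrite inE csize_cons => /orP[/eqP ->|/IH]; lia.
Qed.

(** One shortened model is kept for each formula of [F] that has one. [F] will contain negations of
    formulas of the instance, so it is only asked that shortening preserve the values. *)
Lemma exists_valuations (y : instance) (S F : seq formula) :
  {subset S <= iforms y} ->
  (forall f, f \in F -> forall v, eval (vmem (shorten y v)) f = eval v f) ->
  exists V : seq valuation,
    [/\ size V <= size F, forall l, l \in V -> csize l <= csize y &
      forall f v, f \in F -> models v S -> eval v f -> sat V S f].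
Proof.
move=> HS; elim: F => [|f F IH] HF; first by exists [::].
have [|V [sV bV HV]] := IH; first by move=> g gF; apply: HF; rewrite inE gF orbT.
have [[v vS vf]|no] := pselect (exists2 v, models v S & eval v f); last first.
  exists V; split=> //=; first exact: leqW.
  move=> g v; rewrite inE => /orP[/eqP -> vS vf|]; last exact: HV.
  by case: no; exists v.
exists (shorten y v :: V); split=> //=.
  by move=> l; rewrite inE => /orP[/eqP ->|/bV //]; exact: csize_shorten.
move=> g w; rewrite inE => /orP[/eqP -> _ _|gF wS wg]; last by rewrite (HV _ _ gF wS wg) orbT.
rewrite HF ?inE ?eqxx // vf andbT; apply/orP; left.
by move: vS; rewrite /models => /allP H; apply/allP => h hS;
  rewrite eval_shorten ?H // HS.
Qed.

(** * Correctness of the verifier *)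

Section Shorten.
Variables (y : instance) (G : seq default).
Hypothesis GD : {subset G <= defaults y}.

Lemma th_iforms : {subset th (facts y) G <= iforms y}.
Proof.
move=> f; rewrite mem_cat => /orP[fy|/mapP[d dG ->]].
  by rewrite !mem_cat fy.
by apply: mem_iforms (GD dG) _; rewrite !inE eqxx orbT.
Qed.

Lemma models_shorten (v : nat -> bool) :
  models (vmem (shorten y v)) (th (facts y) G) = models v (th (facts y) G).
Proof. by apply: eq_in_all => f /th_iforms; exact: eval_shorten. Qed.

End Shorten.

(** It makes quantification over short challenges equivalent to quantification over all
    valuations. *)
Lemma check_shorten (y : instance) (G : seq default) (V : seq valuation)
    (v : nat -> bool) :
  check (defaults y) (facts y) G V (vmem (shorten y v)) =
  check (defaults y) (facts y) G V v.
Proof.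
(* If [G] contains a foreign default both sides are false; otherwise every formula evaluated under
   [v] belongs to the instance. *)
rewrite /check; case: (boolP (all (fun d => d \in defaults y) G)) => //= /allP GD0.
have GD : {subset G <= defaults y} by move=> d /GD0.
have -> : grounded (vmem (shorten y v)) (facts y) G = grounded v (facts y) G.
  elim/last_ind: G {GD0} GD => [|G' d IH] GD.
    have sub0 : {subset [::] <= defaults y} by [].
    by have := models_shorten sub0 v; rewrite /th /= cats0.
  have GD' : {subset G' <= defaults y}.
    by move=> e eG; apply: GD; rewrite mem_rcons inE eG orbT.
  rewrite !grounded_rcons (IH GD') (models_shorten GD') eval_shorten //.
  apply: (@mem_iforms _ d); last by rewrite inE eqxx.
  by apply: GD; rewrite mem_rcons inE eqxx.
do 3 congr andb; apply: eq_in_all => d dD; apply: eq_in_all => b db.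
rewrite (models_shorten GD) eval_shorten //.
by apply: mem_iforms dD _; rewrite !inE db !orbT.
Qed.

Section Bounds.
Variables (y : instance).
Let n := size (enc_instance y).
Let M := 10 * n.

Lemma csize_defaults : csize (defaults y) <= M.
Proof.
apply: leq_trans (csize_instance y).
have -> : csize y = (csize (defaults y) + (csize (facts y) +
  (csize (priority y) + csize (query y)).+1).+1).+1 by [].
by lia.
Qed.

Lemma csize_sub (G : seq default) :
  uniq G -> {subset G <= defaults y} -> csize G <= M * M.+1 + 1.
Proof.
move=> uG GD; apply: leq_trans (csize_bound (b := M) _) _.
  by move=> d /GD/csize_mem H; apply: leq_trans H csize_defaults.
rewrite leq_add2r leq_mul2r; apply/orP; right.
apply: leq_trans (uniq_leq_size uG GD) _.
exact: leq_trans (ltnW (size_le_csize _)) csize_defaults.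
Qed.

Lemma csize_valuations (V : seq valuation) :
  size V <= M.+1 -> (forall l, l \in V -> csize l <= csize y) ->
  csize V <= M.+1 * M.+1 + 1.
Proof.
move=> sV HV; apply: leq_trans (csize_bound (b := M) _) _.
  by move=> l /HV H; apply: leq_trans H (csize_instance y).
by rewrite leq_add2r leq_mul2r sV orbT.
Qed.

Lemma csize_pairs (p : pred (default * default)) :
  csize [seq q <- [seq (d, e) | d <- defaults y, e <- defaults y] | p q] <=
  M * M * (2 * M + 2) + 1.
Proof.
apply: leq_trans (csize_bound (b := 2 * M + 1) _) _.
  case=> d e; rewrite mem_filter => /andP[_ /allpairsP[[d' e']]].
  case=> /= dD eD [-> ->]; rewrite csize_pair.
  have Hd : csize (d' : default) <= M.
    exact: leq_trans (csize_mem dD) csize_defaults.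
  have He : csize (e' : default) <= M.
    exact: leq_trans (csize_mem eD) csize_defaults.
  by move: Hd He; rewrite /=; lia.
rewrite leq_add2r; apply: leq_mul; last lia.
apply: (@leq_trans (size [seq (d, e) | d <- defaults y, e <- defaults y])).
  by rewrite size_filter count_size.
rewrite size_allpairs.
by apply: leq_mul; exact: leq_trans (ltnW (size_le_csize _)) csize_defaults.
Qed.

Lemma size_witnessed : size (witnessed (defaults y)) <= M.
Proof.
apply: leq_trans csize_defaults; rewrite /witnessed.
elim: (defaults y) => //= d D IH; rewrite size_cat csize_cons /=.
have -> : csize d = (csize (prereq d) + (csize (justs d) + csize (concl d)).+1).+1.
  by [].
have : size (justs d) < csize (justs d) by exact: size_le_csize.
by lia.
Qed.

End Bounds.

Lemma mem_prio_pairs (D : seq default) (T : default -> default -> Prop) d e :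
  (forall d e, T d e -> d \in D /\ e \in D) ->
  (d, e) \in [seq q <- [seq (d, e) | d <- D, e <- D] | `[< T q.1 q.2 >]] <->
  T d e.
Proof.
move=> TD; rewrite mem_filter /=; split=> [/andP[/asboolP //]|Tde].
apply/andP; split; first exact/asboolP.
by have [dD eD] := TD _ _ Tde; apply: allpairs_f.
Qed.

Lemma size_to_bits {T : Type} {cT : coded T} (x : T) :
  size (to_bits x) = csize x.
Proof. exact: size_tbits. Qed.

Section Correctness.
Variable x : seq bool.
Let n := size x.
Let M := 10 * n.
(** Cubic because of the order: a list of at most [M * M] pairs of size at most [2 * M + 1]. The
    other components of a move are at most quadratic in [M]. *)
Let bound := (2 * M + 8) ^ 3.

Definition game : Prop :=
  forall u1, size u1 <= bound -> exists u2, size u2 <= bound /\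
    forall u3, size u3 <= bound ->
      verify (x, (of_bits u1, (of_bits u2, of_bits u3))).

Lemma shorten_short (y : instance) (v : nat -> bool) :
  enc_instance y = x -> size (to_bits (shorten y v)) <= bound.
Proof.
move=> E; rewrite size_to_bits; apply: leq_trans (csize_shorten y v) _.
apply: leq_trans (csize_instance y) _; rewrite E -/n -/M /bound.
by rewrite !expnS expn0; nia.
Qed.

Lemma extension_certificate (y : instance) (E : set formula) :
  enc_instance y = x -> extension [set` defaults y] [set` facts y] E ->
  exists G V,
    [/\ csize G <= M * M.+1 + 1 /\ csize V <= M.+1 * M.+1 + 1,
        E = theory (th (facts y) G), {subset G <= defaults y},
        forall d, d \in defaults y -> appl d E <-> d \in G &
        (forall v, check (defaults y) (facts y) G V v) /\
        (~ E (query y) -> sat V (th (facts y) G) (Neg (query y)))].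
Proof.
move=> Ey /extension_generated[G [uG GD EE aG gG]].
(* With the negated query added to the witnessed formulas, [V] also shows that the query is missing
   from [E]. *)
have [||V [sV bV HV]] := @exists_valuations y (th (facts y) G)
  (Neg (query y) :: witnessed (defaults y)).
- exact: th_iforms.
- move=> f; rewrite inE => /orP[/eqP -> v /=|/flattenP[fs /mapP[d dy ->]]].
    by rewrite eval_shorten // !mem_cat inE eqxx !orbT.
  rewrite inE => /orP[/eqP -> v /=|fd v]; rewrite eval_shorten //;
    apply: (mem_iforms dy); first by rewrite inE eqxx.
  by rewrite !inE fd !orbT.
exists G, V; split=> //.
  rewrite /M /n -Ey; split; first exact: csize_sub.
  by apply: csize_valuations => //; apply: leq_trans sV _; rewrite ltnS size_witnessed.
split.
  apply: check_complete => //; first by rewrite -EE.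
  by move=> f v fD; apply: HV; rewrite inE fD orbT.
rewrite EE => nq.
have [v vS vq] : exists2 v, models v (th (facts y) G) & eval v (Neg (query y)).
  apply: contra_notP nq => H; apply/theoryP => v vS; apply: contrapT => vq.
  by apply: H; exists v => //=; apply/negP.
by apply: HV vS vq; rewrite inE eqxx.
Qed.

Lemma verifyE (y : instance) (G G' : seq default) (V V' : seq valuation)
    (T : seq (default * default)) (v w : valuation) :
  verify (x, ((G, (V, T)), ((y, (v, (G', V'))), w))) =
  [&& enc_instance y == x, po_ok (defaults y) (priority y) &
      refutes y G V T (vmem v) ==>
      (check (defaults y) (facts y) G' V' (vmem w) && unbeaten G G' T)].
Proof. by []. Qed.

(** A claim that fails at some valuation is answered by that valuation. Any other claim describes an
    extension without the query and a total order extending the priorities; the extension is not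
    preferred, so some [E'] violates the condition for this order, and its certificate is the
    answer. *)
Lemma game_complete (y : instance) :
  valid_instance y -> skeptical_consequence y -> x = enc_instance y -> game.
Proof.
move=> Vy Sy Ex u1 _; have poy : po_ok (defaults y) (priority y) by exact/po_okP.
case: (of_bits u1 : claim) => [G [V T]].
have [allv|/existsNP[v nv]] := pselect (forall v, refutes y G V T v); last first.
  (* The challenge succeeds, so the empty certificate for [E'] is only a filler. *)
  exists (to_bits ((y, (shorten y v, ([::], [::]))) : reply)); split.
    rewrite size_to_bits !csize_pair.
    have H1 := csize_shorten y v; have H2 := csize_instance y.
    rewrite -Ex -/n -/M in H2; rewrite (_ : csize [::] = 1) //.
    by rewrite (_ : csize [::] = 1) // /bound !expnS expn0; nia.
  move=> u3 _; rewrite to_bitsK verifyE -Ex eqxx poy /=.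
  by apply/implyP => H; case: nv; move: H; rewrite /refutes check_shorten.
have okv v : check (defaults y) (facts y) G V v by case/and5P: (allv v).
have /and5P[_ nq /po_okP poT /allP totT /allP subT] := allv xpredT.
pose E := theory (th (facts y) G).
have extE : extension [set` defaults y] [set` facts y] E.
  exact: check_extension okv.
have nE : ~ E (query y).
  by move/theoryP => H; have [v /H] := sat_theory nq; rewrite /= => ->.
have npref : ~ preferred [set` defaults y] [set` facts y] (prio_rel y) E.
  by move/Sy.
have [E' [d [extE' dD [dE' dE] none]]] : exists E' d,
    [/\ extension [set` defaults y] [set` facts y] E', d \in defaults y,
      appl_not d E' E &
      forall e, e \in defaults y -> (e, d) \in T -> ~ appl_not e E E'].
  apply: contra_notP npref => H; split=> //.
  exists (fun d e => (d, e) \in T); split.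
  - split; first exact: poT.
    move=> d e dD eD de; have /allP/(_ _ eD)/or3P[/eqP //||] := totT _ dD.
      by left.
    by right.
  - by move=> d e de; apply: subT.
  - move=> E' d extE' dD dE'; apply: contrapT => H'; apply: H.
    exists E', d; split=> // e eD ed eE; apply: H'.
    by exists e; split.
have [G' [V' [[bG bV] EE' GD' aG' [okG' _]]]] :=
  extension_certificate (esym Ex) extE'.
(* No challenge can succeed against this claim; the empty valuation is a filler. *)
exists (to_bits ((y, ([::], (G', V'))) : reply)); split.
  rewrite size_to_bits !csize_pair.
  have H2 := csize_instance y; rewrite -Ex -/n -/M in H2.
  rewrite (_ : csize [::] = 1) // /bound.
  by rewrite !expnS expn0; nia.
move=> u3 _; rewrite to_bitsK verifyE -Ex eqxx poy andTb andTb.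
apply/implyP => _; rewrite okG' /=; apply/hasP; exists d.
  by apply/aG'.
have aG e : e \in defaults y -> appl e E <-> e \in G by exact: check_appl.
apply/andP; split; first by apply/negP => /(aG d dD).
apply/allP => e eG; apply/implyP => /andP[_ eG'].
have eD : e \in defaults y.
  by have /and5P[/allP H _ _ _ _] := okv xpredT; apply: H.
apply/negP => ed; apply: (none e eD ed); split; first exact/aG.
by move/(aG' e eD); apply/negP.
Qed.

(** A preferred extension without the query would supply a claim that withstands all challenges; the
    reply would then certify an [E'] contradicting the preference condition. *)
Lemma game_sound : game -> skeptical_language x.
Proof.
(* The empty claim is played only to obtain the decoded instance and its validity from the reply. *)
move=> H; have [u2 [_ /(_ [::] isT)]] := H [::] isT.
case: (of_bits [::] : claim) => [G0 [V0 T0]].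
case: (of_bits u2 : reply) => [y [v0 [G1 V1]]].
rewrite verifyE => /and3P[/eqP Ey poy _].
exists y; split=> //; first exact/po_okP.
move=> E [extE [T [[poT totT] subT prefT]]]; apply: contrapT => nq.
have [G [V [[bG bV] EE GD aG [okG satV]]]] := extension_certificate Ey extE.
have TD d e : T d e -> d \in defaults y /\ e \in defaults y.
  by case: poT => + _ _; apply.
set T' := [seq q <- [seq (d, e) | d <- defaults y, e <- defaults y] |
  `[< T q.1 q.2 >]].
have memT d e : (d, e) \in T' <-> T d e by exact: mem_prio_pairs.
have ref v : refutes y G V T' v.
  apply/and5P; split=> //.
  - exact: satV.
  - apply/po_okP; have -> : (fun d e => is_true ((d, e) \in T')) = T.
      by apply/funext => d; apply/funext => e; apply/propext.
    exact: poT.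
  - apply/allP => d dD; apply/allP => e eD; apply/or3P.
    have [->|/eqP de] := eqVneq d e; first exact: Or31.
    by case: (totT _ _ dD eD de) => /memT; [exact: Or32 | exact: Or33].
  - by apply/allP => -[d e] /subT/memT.
have [|u2' [_ H2]] := H (to_bits ((G, (V, T')) : claim)).
  rewrite size_to_bits !csize_pair.
  have bT : csize T' <= M * M * (2 * M + 2) + 1.
    by rewrite /M /n -Ey; exact: csize_pairs.
  by rewrite /bound !expnS expn0; nia.
rewrite to_bitsK in H2.
case: (of_bits u2' : reply) H2 => [y' [v' [G' V']]] H2.
have Ey' : y' = y.
  have := H2 [::] isT; rewrite verifyE => /and3P[/eqP E' _ _].
  by apply: enc_instance_inj; rewrite E' Ey.
rewrite {}Ey' in H2.
(* Only short challenges can be played, but each valuation has a short one with the same outcome. *)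
have okv v : check (defaults y) (facts y) G' V' v /\ unbeaten G G' T'.
  have := H2 _ (shorten_short v Ey); rewrite to_bitsK verifyE ref check_shorten.
  by case/and3P => _ _ /andP[-> ->].
have ok' v := (okv v).1.
have [_ /hasP[d dG' /andP[dG /allP none]]] := okv xpredT.
have dD : d \in defaults y.
  by have /and5P[/allP GD' _ _ _ _] := ok' xpredT; apply: GD'.
have aG' e : e \in defaults y -> appl e (theory (th (facts y) G')) <-> e \in G'.
  exact: check_appl.
have [|e [eD ed [eE eE']]] := prefT _ d (check_extension ok') dD.
  by split; [apply/aG' | move/(aG d dD); apply/negP].
have eG : e \in G by apply/aG.
have := none e eG; rewrite eG /= => /implyP H'.
have : (e, d) \notin T' by apply: H'; apply/negP => /(aG' e eD).
by rewrite (memT e d).2.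
Qed.

End Correctness.

Theorem theorem5p9 : in_Pi_p 3 skeptical_language.
Proof.
(* For inputs of length n, [(20n + 8) ^ 3] is the bound on the moves in [game], where [M] is 10n. *)
have [q Hq] := poly_nat 20 8 0 0 3.
exists [set w | verify_strings (split_letters (map letter w))], q; split.
  apply: (@in_P_polyf (fun w => verify_strings (split_letters w))).
  exact: (polyf_comp polyf_verify_strings polyf_split_letters).
move=> x; rewrite Hq mul0n !addn0 (_ : 20 * size x = 2 * (10 * size x)); last lia.
have -> : skeptical_language x = game x.
  apply/propext; split; last exact: game_sound.
  by case=> y [Vy Sy Ex]; apply: game_complete Ex.
rewrite /= /game; split=> H u1 s1; have [u2 [s2 H2]] := H u1 s1; exists u2;
  split=> // u3 s3; have := H2 u3 s3; by rewrite split_tuple_string.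
Qed.
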